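(* Let $k \geq 1$ and $d = 2k+1$. There is a constant $C$ depending only on $k$ such that for every $n \geq 2$ and every sufficiently small $\Delta > 0$ (depending on $n$ and $k$), the set $A = A_d(n,\Delta)$ of $N = (k+1)(n+1)$ points admits radii $\rho_0 < \rho_1 < \cdots < \rho_{2k}$ with $$\Big|\beta_p(\check{C}(A,\rho_p)) - \binom{k+1}{p+1}(n+1)^{p+1}\Big| \leq C \quad \text{for } 0 \leq p \leq k,$$ $$\Big|\beta_p(\check{C}(A,\rho_p)) - \binom{k}{p-k}(n+1)^{k+1}\Big| \leq C n^k \quad \text{for } k+1 \leq p \leq 2k.$$
   Context: Construction of $A_d(n,\Delta)$, $d = 2k+1$: use Cartesian coordinates $x_1,\dots,x_d$ with standard basis $e_1,\dots,e_d$. Let $\Sigma$ be a regular $k$-simplex with unit-length edges in the $k$-plane spanned by $x_1,\dots,x_k$, with barycenter at the origin, and vertices $u_0,\dots,u_k$. Let $v_\ell$ be the barycenter of the facet of $\Sigma$ opposite $u_\ell$. Its height is $H_k = \|u_\ell - v_\ell\| = \sqrt{(k+1)/(2k)}$. For $0 \leq \ell \leq k$, let $C_\ell$ be the circle centered at $v_\ell$, of radius $H_k$, lying in the $2$-plane through $v_\ell$ spanned by $u_\ell - v_\ell$ and $e_{k+\ell+1}$ (so $C_\ell$ passes through $u_\ell$). Given $0 < \Delta < H_k$, cut $C_\ell$ at the two lines $x_{k+\ell+1} = \pm\Delta$ into four arcs, and place $n+1$ points at equal angular spacing (including the two arc endpoints) along the arc that passes through $u_\ell$. The union over $\ell$ of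 these points is $A_d(n,\Delta)$. The Čech complex $\check{C}(A,r)$ is the abstract simplicial complex of all nonempty subsets of $A$ whose closed balls of radius $r$ have nonempty common intersection; $\beta_p$ denotes the reduced $p$-th Betti number. *)

(* Defs.v *)
From HB Require Import structures.
From mathcomp Require Import all_boot all_order all_algebra finmap.
From mathcomp Require Import boolp reals trigo.

Set Implicit Arguments.
Unset Strict Implicit.
Unset Printing Implicit Defensive.

Import Order.TTheory GRing.Theory Num.Theory.

Local Open Scope ring_scope.
Local Open Scope fset_scope.

(* Reduced simplicial homology with coefficients in a field F, for a finite
   abstract simplicial complex given as a downward closed set K of nonempty
   subsets of T. *)
Section ReducedHomology.
Variables (F : fieldType) (T : finType).
Implicit Types (K : {set {set T}}) (s t : {set T}).

(* Indexed by cardinality m, i.e. by dimension m - 1. Adjoining the empty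
   simplex is what makes the homology reduced. *)
Definition faces K (m : nat) : {set {set T}} :=
  [set s in set0 |: K | #|s| == m].

(* The coefficient of t in the boundary of s, every simplex being oriented by
   the enumeration order of T: removing the i-th vertex has sign (-1)^i. *)
Definition incidence s t : F :=
  \sum_(v in s | s :\ v == t)
    (-1) ^+ #|[set w in s | (enum_rank w < enum_rank v)%N]|.

(* The boundary map from p-chains to (p-1)-chains, acting on row vectors. *)
Definition boundary K (p : nat) : 'M[F]_(#|faces K p.+1|, #|faces K p|) :=
  \matrix_(i, j) incidence (enum_val i) (enum_val j).

(* The dimension of (p-cycles) / (p-boundaries). *)
Definition reduced_betti K (p : nat) : nat :=
  (\rank (kermx (boundary K p)) - \rank (boundary K p.+1))%N.

End ReducedHomology.

Section Cech.
Variables (R : realType) (d : nat).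

(* The library norm on row vectors is the sup norm; this is the Euclidean one. *)
Definition enorm (x : 'rV[R]_d) : R := Num.sqrt (\sum_i x 0 i ^+ 2).

Definition in_cball (a : 'rV[R]_d) (r : R) (x : 'rV[R]_d) : Prop :=
  enorm (x - a) <= r.

Definition cech (A : {fset 'rV[R]_d}) (r : R) : {set {set A}} :=
  [set s : {set A} | (s != set0) &&
     `[< exists x, forall a : A, a \in s -> in_cball (val a) r x >]].

End Cech.

(* The ambient space has dimension k + k.+1 = 2k + 1: coordinates lshift _ i are
   x_1, ..., x_k, and rshift k l is the coordinate x_(k+l+1), for 0 <= l <= k. *)
Section Construction.
Variables (R : realType) (k : nat).
Local Notation point := 'rV[R]_(k + k.+1).

Definition unit_regular_simplex (u : 'I_k.+1 -> point) : Prop :=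
  [/\ forall l j : 'I_k.+1, u l 0 (rshift k j) = 0,
      forall l j : 'I_k.+1, l != j -> enorm (u l - u j) = 1
    & k.+1%:R^-1 *: \sum_l u l = 0].

Definition facet_barycenter (u : 'I_k.+1 -> point) (l : 'I_k.+1) : point :=
  k%:R^-1 *: \sum_(j | j != l) u j.

Definition height : R := Num.sqrt (k.+1%:R / (2 * k)%:R).

(* The point of the circle C_l at angle theta from u_l; note that
   u_l - v_l has norm height. *)
Definition circle_point (u : 'I_k.+1 -> point) (l : 'I_k.+1) (theta : R) :
    point :=
  facet_barycenter u l + cos theta *: (u l - facet_barycenter u l)
  + (height * sin theta) *: delta_mx 0 (rshift k l).

(* The arc through u_l between the lines x_(k+l+1) = -Delta and
   x_(k+l+1) = Delta consists of the angles in [- alpha, alpha], where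
   alpha = asin (Delta / height). *)
Definition arc_angle (n : nat) (Delta : R) (i : 'I_n.+1) : R :=
  let alpha := asin (Delta / height) in
  - alpha + i%:R * (2 * alpha / n%:R).

Definition arc_points (u : 'I_k.+1 -> point) (n : nat) (Delta : R) :
    {fset point} :=
  [fset circle_point u l (arc_angle Delta i) | l in 'I_k.+1, i in 'I_n.+1].

End Construction.

(* Main.v *)
(* A point at angle [t] on the l-th circle and one at angle [t'] on the j-th are
   at squared distance [1 + 2 H^2 (1 - cos t) (1 - cos t') / k], so points on
   different arcs are at distance 1 up to fourth order in the arc angle, whereas
   points on one arc are separated at first order.  By the variance identity, a
   set meeting G arcs, in index intervals of widths m_1, m_2, and so on, has
   squared circumradius [(1 - 1/G) / 2 + H^2 d^2 (m_1^2 + m_2^2 + ...) / (4 G^2)]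
   up to lower-order terms, d being the angular spacing.  Hence for suitable radii
   the Cech complex consists of the sets meeting fewer than G arcs, and of those
   meeting G arcs with [m_1^2 + m_2^2 + ... <= j].

   Discrete Morse theory computes its Betti numbers.  Toggle the successor of the
   minimum of the first part of width at least 2 or, if there is none, of the first
   part different from {n}.  The unmatched faces are at most 2^(k+1) sets of top
   points, and the faces of dimension G - 1 + j in which j parts are pairs of
   consecutive points, the other parts are single points, and the first part other
   than {n} is a single point.  Taking (G, j) = (p + 1, 0) for p <= k and
   (k + 1, p - k) for p >= k gives the theorem. *)
Require Import Defs.
From HB Require Import structures.
From mathcomp Require Import all_boot all_order all_algebra finmap.
From mathcomp Require Import boolp reals trigo.
From mathcomp Require Import topology normedtype derive.
From mathcomp Require Import ring lra zify.

Set Implicit Arguments.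
Unset Strict Implicit.
Unset Printing Implicit Defensive.

Import Order.TTheory GRing.Theory Num.Theory.

Local Open Scope ring_scope.

(** * Discrete Morse matchings *)

Section BettiRank.
Variables (F : fieldType) (T : finType).
Implicit Types (K : {set {set T}}) (s t u : {set T}).

Definition down_closed K := forall s t, s \in K -> t \subset s -> t != set0 -> t \in K.

Lemma faces_sub K s t : down_closed K -> s \in set0 |: K -> t \subset s ->
  t \in set0 |: K.
Proof.
move=> dK; rewrite !inE => sK ts; have [//|tn0] := eqVneq t set0.
case/predU1P: sK => [s0|sK]; first by rewrite s0 subset0 (negPf tn0) in ts.
exact: dK sK ts tn0.
Qed.

Lemma facesP K m s : (s \in faces K m) = (s \in set0 |: K) && (#|s| == m).
Proof. by rewrite inE. Qed.

Definition orient s (v : T) : F := (-1) ^+ #|[set w in s | (enum_rank w < enum_rank v)%N]|.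

Lemma incidenceE s t : incidence F s t = \sum_(v in s | s :\ v == t) orient s v.
Proof. by []. Qed.

(** Removing [v] first lowers by one the number of vertices before [w], whereas removing [w] first
    does not affect the vertices before [v]. *)
Lemma orientD1 s v w : v \in s -> w \in s -> (enum_rank v < enum_rank w)%N ->
  orient s v * orient (s :\ v) w = - (orient s w * orient (s :\ w) v).
Proof.
move=> vs ws vw; rewrite /orient.
have -> : [set x in s :\ w | (enum_rank x < enum_rank v)%N]
        = [set x in s | (enum_rank x < enum_rank v)%N].
  apply/setP=> x; rewrite !inE; case: eqVneq => //= ->.
  by rewrite ltnNge (ltnW vw) andbF.
rewrite [in RHS](cardsD1 v [set x in s | (enum_rank x < enum_rank w)%N]) inE vs vw.
have -> : [set x in s | (enum_rank x < enum_rank w)%N] :\ v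
        = [set x in s :\ v | (enum_rank x < enum_rank w)%N].
  by apply/setP=> x; rewrite !inE andbA.
by rewrite exprS mulN1r mulNr opprK mulrC.
Qed.

Lemma boundaryM0 K p : down_closed K -> boundary F K p.+1 *m boundary F K p = 0.
Proof.
move=> dK; apply/matrixP => i k; rewrite !mxE.
under eq_bigr => j _ do rewrite !mxE.
set s := enum_val i; set t := enum_val k.
have /[!facesP]/andP[sK /eqP sp] : s \in faces K p.+2 by exact: enum_valP.
rewrite -(big_enum_val (A := mem (faces K p.+1))
  (fun u => incidence F s u * incidence F u t)) /=.
(* The middle face is determined by the first deleted vertex [v], so the sum runs over ordered pairs
   of deleted vertices. *)
have -> : \sum_(u in faces K p.+1) incidence F s u * incidence F u t =
  \sum_(v in s) \sum_(w in s | (w != v) && (s :\ v :\ w == t))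
     orient s v * orient (s :\ v) w.
  under eq_bigr => u _ do rewrite incidenceE mulr_suml.
  rewrite (exchange_big_dep (mem s)) /=; last by move=> u v _ /andP[].
  apply: eq_bigr => v vs.
  rewrite (big_pred1 (s :\ v)) => [|u /=]; last first.
    rewrite vs /= [RHS]eq_sym; case: eqVneq => [<-|]; rewrite ?andbF //.
    rewrite andbT facesP (faces_sub dK sK) ?subsetDl //=.
    by move: sp; rewrite (cardsD1 v) vs add1n => -[->]; exact: eqxx.
  rewrite incidenceE mulr_sumr; apply: eq_bigl => w.
  by rewrite !inE; case: (w == v); rewrite //= andbF.
rewrite pair_big_dep /=.
pose Q (x : T * T) := [&& x.1 \in s, x.2 \in s, x.2 != x.1 & s :\ x.1 :\ x.2 == t].
rewrite (eq_bigl Q); last by move=> x; rewrite /Q.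
pose L (x : T * T) := (enum_rank x.1 < enum_rank x.2)%N.
(* Swapping the pairs deleted in decreasing order makes both sums run over increasing pairs, where
   [orientD1] cancels them term by term. *)
have -> : \sum_(x | Q x) orient s x.1 * orient (s :\ x.1) x.2 =
  \sum_(x | Q x && L x) orient s x.1 * orient (s :\ x.1) x.2 +
  \sum_(x | Q x && L x) orient s x.2 * orient (s :\ x.2) x.1.
  rewrite (bigID L); congr (_ + _).
  pose sw (x : T * T) := (x.2, x.1).
  rewrite (reindex_inj (h := sw)); last by move=> [a b] [c d] [-> ->].
  apply: eq_bigl => -[v w]; rewrite /Q /L /sw /=.
  rewrite [v == w]eq_sym [s :\ w :\ v](_ : _ = s :\ v :\ w); last first.
    by apply/setP=> x; rewrite !inE andbCA.
  case: (eqVneq w v) => [->|wv]; first by rewrite !andbF.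
  rewrite -leqNgt [in RHS]ltn_neqAle.
  have -> : enum_rank v != enum_rank w :> nat.
    by apply: contra wv => /eqP/val_inj/enum_rank_inj ->.
  by rewrite /=; case: (v \in s); case: (w \in s); rewrite ?andbF.
rewrite -big_split big1 //= => -[v w] /= /andP[/and4P[/= vs ws _ _] vw].
by rewrite orientD1 // addNr.
Qed.

End BettiRank.

(** * Morse inequalities from an acyclic matching *)

Section Matching.
Variables (T : finType) (tog : {set T} -> T -> bool) (pot : {set T} -> nat).
Implicit Types (K : {set {set T}}) (s t u : {set T}) (x y z : T).

(* [tog s] is the vertex by which [s] differs from its partner in a matching of
   all finite sets; [pot] certifies that the matching has no closed gradient
   path. *)
Hypothesis tog_uniq : forall s x y, tog s x -> tog s y -> x = y.
Hypothesis tog_del : forall s x, tog s x -> x \in s -> tog (s :\ x) x.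
Hypothesis tog_add : forall s x, tog s x -> x \notin s -> tog (x |: s) x.
Hypothesis tog_pot : forall s x y z, tog s x -> x \in s -> y \notin s ->
  tog (y |: s :\ x) z -> z \in y |: s :\ x -> (pot s < pot (y |: s :\ x))%N.

Definition matched_down K m := [set s in faces K m | [exists x, tog s x && (x \in s)]].
Definition matched_up K m :=
  [set s in faces K m | [exists x, [&& tog s x, x \notin s & x |: s \in K]]].
(** A face with no toggled vertex at all is critical as well. *)
Definition critical K m :=
  [set s in faces K m | ~~ [exists x, tog s x && ((x \in s) || (x |: s \in K))]].

Lemma faces_partition K m :
  #|faces K m| = (#|matched_down K m| + #|matched_up K m| + #|critical K m|)%N.
Proof.
rewrite -[LHS](cardsID [set s | [exists x, tog s x && ((x \in s) || (x |: s \in K))]]).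
congr (_ + _)%N; last first.
  by congr #|pred_of_set _|; apply/setP => s; rewrite !inE andbC.
rewrite -[LHS](cardsID [set s | [exists x, tog s x && (x \in s)]]).
congr (_ + _)%N; congr #|pred_of_set _|; apply/setP => s; rewrite !inE.
  rewrite -andbA; congr (_ && _); apply: andb_idl.
  by case/existsP => x /andP[sx xs]; apply/existsP; exists x; rewrite sx xs.
rewrite andbC -andbA; congr (_ && _); apply/andP/existsP.
  case=> /existsP[x /andP[sx /orP[xs|xK]]] /existsPn nD.
    by have := nD x; rewrite sx xs.
  by exists x; rewrite sx xK andbT /=; have := nD x; rewrite sx.
case=> x /and3P[sx xs xK]; split.
  by apply/existsP; exists x; rewrite sx xK orbT.
by apply/existsPn => y; apply/negP => /andP[sy]; rewrite -(tog_uniq sx sy) (negPf xs).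
Qed.

(** Deleting the toggled vertex is a bijection, inverse to adding it; downward closure keeps the
    smaller face in the complex. *)
Lemma card_matched K m : down_closed K -> #|matched_down K m.+1| = #|matched_up K m|.
Proof.
move=> dK; pose del s := if [pick x | tog s x] is Some x then s :\ x else s.
have delE s x : tog s x -> del s = s :\ x.
  rewrite /del; case: pickP => [y sy sx|/(_ x) -> //]; by rewrite (tog_uniq sx sy).
have downP s : reflect (s \in faces K m.+1 /\ exists2 x, tog s x & x \in s)
                       (s \in matched_down K m.+1).
  rewrite [s \in matched_down K m.+1]inE; apply: (iffP andP) => -[sF].
    by case/existsP=> x /andP[sx xs]; split=> //; exists x.
  by case=> x sx xs; split=> //; apply/existsP; exists x; rewrite sx.
rewrite -(card_in_imset (f := del)) => [|s t].
  congr #|pred_of_set _|; apply/setP => s; apply/imsetP/idP => [[t /downP[]]|].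
    rewrite facesP => /andP[tK /eqP tm] [x tx xt] ->; rewrite (delE _ _ tx) inE facesP.
    rewrite (faces_sub dK tK) ?subsetDl //=.
    move: (tm); rewrite (cardsD1 x) xt add1n => -[->]; rewrite eqxx /=.
    apply/existsP; exists x; rewrite tog_del // setD1K // !inE eqxx /=.
    by move: tK; rewrite !inE => /predU1P[t0|//]; rewrite t0 inE in xt.
  rewrite inE facesP => /andP[/andP[sK /eqP sm]] /existsP[x /and3P[sx xs xK]].
  exists (x |: s).
    apply/downP; rewrite facesP cardsU1 xs sm add1n eqxx !inE xK orbT; split=> //.
    by exists x; rewrite ?setU11 // tog_add.
  by rewrite (delE _ x) ?tog_add // setU1K.
move=> /downP[_ [x sx xs]] /downP[_ [y ty yt]].
rewrite (delE _ _ sx) (delE _ _ ty) => st.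
have /(tog_uniq (tog_del sx xs)) xy : tog (s :\ x) y by rewrite st; apply: tog_del.
by rewrite -(setD1K xs) -(setD1K yt) st xy.
Qed.

Variable F : fieldType.

(* The rows of the boundary matrix matched downwards are free: at a face of
   maximal potential in a vanishing combination, the partner of that face is hit
   by no other face of the combination. *)
Lemma matched_down_rank K p : down_closed K ->
  (#|matched_down K p.+1| <= \rank (boundary F K p))%N.
Proof.
move=> dK; set D := matched_down K p.+1.
have DF s : s \in D -> s \in faces K p.+1 by rewrite inE => /andP[].
pose row_of (i : 'I_#|D|) := enum_rank_in (DF _ (enum_valP i)) (enum_val i).
have row_ofE i : enum_val (row_of i) = enum_val i.
  by rewrite enum_rankK_in //; apply/DF/enum_valP.
pose M := rowsub row_of (boundary F K p).
have ME v : v *m M = (\row_j \sum_i if row_of i == j then v 0 i else 0) *m boundary F K p.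
  apply/rowP => k; rewrite !mxE.
  under [RHS]eq_bigr => j _ do rewrite mxE mulr_suml.
  rewrite exchange_big /=; apply: eq_bigr => i _; rewrite mxE.
  rewrite (bigD1 (row_of i)) //= eqxx big1 ?addr0 // => j jn.
  by rewrite eq_sym (negPf jn) mul0r.
have Msub : (M <= boundary F K p)%MS.
  by apply/row_subP => i; rewrite rowE ME submxMl.
suff Mfree : row_free M by rewrite -{1}(eqP Mfree) mxrankS.
apply: inj_row_free => v vM; apply/eqP/negPn/negP => /eqP vn0.
have [i0 vi0] : exists i, v 0 i != 0.
  apply/existsP; rewrite -negb_forall; apply/negP => /forallP v0.
  by apply: vn0; apply/rowP => i; rewrite mxE; apply/eqP.
have [i vi imax] := @arg_maxnP _ i0 (fun i => v 0 i != 0) (fun i => pot (enum_val i)) vi0.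
set s := enum_val i; have : s \in D by exact: enum_valP.
rewrite inE facesP => /andP[/andP[sK /eqP sp]] /existsP[x /andP[sx xs]].
have tF : s :\ x \in faces K p.
  rewrite facesP (faces_sub dK sK) ?subsetDl //=.
  by move: sp; rewrite (cardsD1 x) xs add1n => -[->]; exact: eqxx.
have /rowP/(_ (enum_rank_in tF (s :\ x))) := vM.
rewrite !mxE (bigD1 i) //= big1 => [|j ji]; last first.
  rewrite !mxE row_ofE enum_rankK_in // incidenceE.
  have [->|vj] := eqVneq (v 0 j) 0; first by rewrite mul0r.
  rewrite big1 ?mulr0 // => y /andP[yj /eqP yE].
  have : enum_val j \in D by exact: enum_valP.
  rewrite inE => /andP[_ /existsP[z /andP[jz zj]]].
  (* Another face of the combination with facet [s :\ x] arises by replacing [x] with some [y]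
     outside [s]; [tog_pot] would give it a larger potential than [s]. *)
  have jE : enum_val j = y |: s :\ x by rewrite -yE setD1K.
  have yns : y \notin s.
    apply: contra ji => ys; apply/eqP/enum_val_inj; rewrite jE.
    have : y \notin s :\ x by rewrite -yE !inE eqxx.
    by rewrite !inE ys andbT negbK => /eqP ->; rewrite setD1K.
  rewrite jE in jz zj.
  have /= := imax j vj; rewrite jE /geq /=.
  by rewrite leqNgt (tog_pot sx xs yns jz zj).
rewrite !mxE row_ofE enum_rankK_in // incidenceE addr0 (big_pred1 x) => [|y /=].
  by move/eqP; rewrite mulf_eq0 (negPf vi) /orient signr_eq0.
apply/andP/eqP => [[ys /eqP yE]|-> //].
by apply/eqP; apply: contraTT ys => yx; have := setD11 y s; rewrite yE !inE yx /= => ->.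
Qed.

(** Consecutive boundary maps compose to zero, so the lower bound on one rank given by
    [matched_down_rank] bounds the next rank from above. In degree 0 the number of columns suffices,
    since the empty face is not matched downwards. *)
Lemma boundary_rank_le K p : down_closed K ->
  (\rank (boundary F K p) <= #|matched_down K p.+1| + #|critical K p|)%N.
Proof.
move=> dK; case: p => [|p].
  apply: leq_trans (rank_leq_col _) _; rewrite faces_partition (card_matched _ dK).
  rewrite (_ : matched_down K 0 = set0) ?cards0 //; apply/setP => s; rewrite inE [RHS]inE.
  rewrite facesP cards_eq0; apply/negP => /andP[/andP[_ /eqP ->]] /existsP[x].
  by rewrite inE andbF.
have := mulmx0_rank_max (boundaryM0 F p dK).
have := matched_down_rank p dK.
have := faces_partition K p.+1; rewrite !(card_matched _ dK); lia.
Qed.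

(** Each boundary rank exceeds its number of matched pairs by at most the number of critical faces
    on either side. Matched pairs cancel from the Betti number, which leaves the critical faces up
    to these excesses. *)
Lemma betti_bounds K p : down_closed K ->
  (reduced_betti F K p <= #|critical K p.+1|)%N /\
  (#|critical K p.+1| <= reduced_betti F K p + #|critical K p| + #|critical K p.+2|)%N.
Proof.
move=> dK; rewrite /reduced_betti mxrank_ker.
have := mulmx0_rank_max (boundaryM0 F p dK).
have := matched_down_rank p dK.
have := matched_down_rank p.+1 dK.
have := boundary_rank_le p dK.
have := mulmx0_rank_max (boundaryM0 F p.+1 dK).
have := matched_down_rank p.+2 dK.
have := faces_partition K p.+1; have := faces_partition K p.+2.
rewrite !(card_matched _ dK).
lia.
Qed.

End Matching.

(** * The matching on sets of indexed points *)

Section Toggle.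
Variables (g n : nat).
Local Notation V := ('I_g * 'I_n.+1)%type.
Implicit Types (s t : {set V}) (v w x y z : V) (l : 'I_g) (i : 'I_n.+1).

(** Width at least 2: the successor of the minimum is then strictly between the two ends, so
    toggling it moves neither. *)
Definition wide s l :=
  [exists i1 : 'I_n.+1, exists i2 : 'I_n.+1, [&& (l, i1) \in s, (l, i2) \in s & (i1.+1 < i2)%N]].
Definition some_wide s := [exists l, wide s l].
Definition low s l := [exists i : 'I_n.+1, ((l, i) \in s) && (i < n)%N].
Definition active s l := if some_wide s then wide s l else low s l.
Definition first_active s l :=
  active s l && [forall l' : 'I_g, (l' < l)%N ==> ~~ active s l'].
Definition is_min s l i :=
  ((l, i) \in s) && [forall i' : 'I_n.+1, ((l, i') \in s) ==> (i <= i')%N].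
Definition toggle s v :=
  first_active s v.1 && [exists i : 'I_n.+1, is_min s v.1 i && (v.2 == i.+1 :> nat)].

Lemma wideP s l : reflect (exists i1 i2 : 'I_n.+1,
  [/\ (l, i1) \in s, (l, i2) \in s & (i1.+1 < i2)%N]) (wide s l).
Proof.
apply: (iffP existsP) => -[i1]; first by move=> /existsP[i2 /and3P]; exists i1, i2.
by move=> [i2 /and3P H]; exists i1; apply/existsP; exists i2.
Qed.

Lemma lowP s l : reflect (exists2 i : 'I_n.+1, (l, i) \in s & (i < n)%N) (low s l).
Proof.
by apply: (iffP existsP) => [[i /andP[]]|[i ? ?]]; exists i => //; apply/andP.
Qed.

Lemma is_minP s l i : reflect ((l, i) \in s /\ forall i' : 'I_n.+1, (l, i') \in s -> (i <= i')%N)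
  (is_min s l i).
Proof.
apply: (iffP andP) => -[ls H]; split=> //.
  by move=> i' i's; have /forallP/(_ i')/implyP/(_ i's) := H.
by apply/forallP => i'; apply/implyP/H.
Qed.

Lemma is_min_uniq s l i i' : is_min s l i -> is_min s l i' -> i = i'.
Proof.
move=> /is_minP[a b] /is_minP[c d]; apply: ord_inj; apply/eqP.
by rewrite eqn_leq b // d.
Qed.

Lemma ex_min s v : v \in s -> exists i, is_min s v.1 i.
Proof.
case: v => l i0 i0s; have [i is_ iP] := @arg_minnP _ i0 (fun i => (l, i) \in s) val i0s.
by exists i; apply/is_minP.
Qed.

Lemma first_activeP s l : reflect
  (active s l /\ forall l' : 'I_g, (l' < l)%N -> ~~ active s l') (first_active s l).
Proof.
apply: (iffP andP) => -[al H]; split=> //.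
  by move=> l' l'l; have /forallP/(_ l')/implyP/(_ l'l) := H.
by apply/forallP => l'; apply/implyP/H.
Qed.

Lemma first_active_uniq s l l' : first_active s l -> first_active s l' -> l = l'.
Proof.
move=> /first_activeP[al H] /first_activeP[al' H']; apply: ord_inj; apply/eqP.
rewrite eqn_leq; apply/andP; split; rewrite leqNgt; apply/negP => /=.
  by move/H; rewrite al'.
by move/H'; rewrite al.
Qed.

Lemma ex_first_active s l : active s l -> exists l', first_active s l'.
Proof.
move=> al; have [l' al' lP] := @arg_minnP _ l (active s) val al.
exists l'; apply/first_activeP; split=> // l'' l''l.
by apply: contraL l''l => /lP; rewrite -leqNgt.
Qed.

Lemma toggleP s v : reflect
  (first_active s v.1 /\ exists2 i, is_min s v.1 i & v.2 = i.+1 :> nat) (toggle s v).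
Proof.
apply: (iffP andP) => -[fs]; first by case/existsP=> i /andP[mi /eqP]; split=> //; exists i.
by case=> i mi vi; split=> //; apply/existsP; exists i; rewrite mi vi /=.
Qed.

Lemma toggle_uniq s v w : toggle s v -> toggle s w -> v = w.
Proof.
case: v w => l i [l' i'] /toggleP[/= f1 [m m1 v1]] /toggleP[/= f2 [m' m2 v2]].
have E := first_active_uniq f1 f2; subst l'.
by rewrite (is_min_uniq m1 m2) -v2 in v1; congr pair; apply: ord_inj.
Qed.

Section OffToggle.
Variables (s t : {set V}) (l : 'I_g) (i m : 'I_n.+1).
Hypothesis st : forall w, w != (l, i) -> (w \in s) = (w \in t).
Hypotheses (mi : i = m.+1 :> nat) (ms : is_min s l m).

Lemma off_neq (i' : 'I_n.+1) : i' != m.+1 :> nat -> (l, i') != (l, i).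
Proof. by rewrite -mi; apply: contra => /eqP[->]. Qed.

Lemma off_min : is_min t l m.
Proof.
have /is_minP[ml mP] := ms.
apply/is_minP; split=> [|i' i't]; first by rewrite -st ?off_neq ?neq_ltn ?ltnSn.
have [->|i'm] := eqVneq (i' : nat) m.+1; first exact: leqnSn.
by apply: mP; rewrite st ?off_neq.
Qed.

Lemma off_wide_imp l' : wide s l' -> wide t l'.
Proof.
have /is_minP[ml mP] := ms; case/wideP=> i1 [i2 [s1 s2 i12]].
have [El|nl] := eqVneq l' l; last first.
  by apply/wideP; exists i1, i2; rewrite -!st //; apply: contra nl => /eqP[->].
subst l'; have := mP _ s1; have /is_minP[mt _] := off_min => m1.
have mi2 : (m.+1 < i2)%N by apply: leq_ltn_trans i12; rewrite ltnS.
by apply/wideP; exists m, i2; rewrite -(st (w := (l, i2))) ?off_neq ?neq_ltn ?mi2 ?orbT.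
Qed.
End OffToggle.

Lemma wide_off s t v : (forall w, w != v -> (w \in s) = (w \in t)) -> toggle s v ->
  wide s =1 wide t.
Proof.
case: v => l i st /toggleP[/= _ [m ms mi]] l'.
apply/idP/idP; first exact: (off_wide_imp st mi ms).
apply: (@off_wide_imp t s l i m) => // [w wn|]; first by rewrite st.
exact: (off_min st mi ms).
Qed.

Lemma active_eq s t : wide s =1 wide t -> forall l, low s l = low t l -> active s l = active t l.
Proof. by move=> wst l lst; rewrite /active /some_wide (eq_existsb wst) wst lst. Qed.

(** A set and its partner toggle the same vertex: the minimum [m] survives, wideness is unchanged,
    and [m < n] keeps the part low. *)
Lemma toggle_off s t v : (forall w, w != v -> (w \in s) = (w \in t)) -> toggle s v -> toggle t v.
Proof.
move=> st sv; have wst := wide_off st sv; case: v st sv => l i st.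
move=> /toggleP[/= fs [m ms mi]]; have mt := off_min st mi ms.
apply/toggleP; split=> /=; last by exists m.
have mn : (m < n)%N by rewrite -ltnS -mi ltn_ord.
have lst l' : low s l' = low t l'.
  have [->|nl] := eqVneq l' l.
    apply/idP/idP => _; apply/lowP; exists m => //; by [case/is_minP: mt | case/is_minP: ms].
  by apply: eq_existsb => i'; rewrite st //; apply: contra nl => /eqP[->].
have ast := active_eq wst (lst _).
have /first_activeP[al H] := fs; apply/first_activeP; rewrite -ast; split=> // l'.
by rewrite -(active_eq wst (lst _)); apply: H.
Qed.

Lemma toggle_del s v : toggle s v -> v \in s -> toggle (s :\ v) v.
Proof. by move=> sv vs; apply: toggle_off sv => w wv; rewrite !inE wv. Qed.

Lemma toggle_add s v : toggle s v -> v \notin s -> toggle (v |: s) v.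
Proof. by move=> sv vs; apply: toggle_off sv => w wv; rewrite !inE (negPf wv). Qed.

Lemma wideS s t l : s \subset t -> wide s l -> wide t l.
Proof.
move=> /subsetP st /wideP[i1 [i2 [s1 s2 i12]]].
by apply/wideP; exists i1, i2; split=> //; apply: st.
Qed.

Lemma wide_del s v : toggle s v -> wide s =1 wide (s :\ v).
Proof. by move=> sv; apply: wide_off sv => w wv; rewrite !inE wv. Qed.

Definition code v : nat := v.1 * n.+1 + v.2.
Let M := (g * n.+1)%N.
(** A lexicographic pair packed into one number: the sum is at most [M * M], so the number of wide
    parts dominates. *)
Definition potential s :=
  (#|[set l | wide s l]| * (M * M).+1 + \sum_(v in s) (M - code v))%N.

Lemma code_lt v : (code v < M)%N.
Proof.
rewrite /code /M; apply: (@leq_trans (v.1 * n.+1 + n.+1)); first by rewrite ltn_add2l.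
by rewrite -mulSnr leq_mul2r ltn_ord orbT.
Qed.

Lemma potential_lt s v y : toggle s v -> v \in s -> y \notin s ->
  (#|[set l | wide s l]| < #|[set l | wide (y |: s :\ v) l]|)%N || (code y < code v)%N ->
  (potential s < potential (y |: s :\ v))%N.
Proof.
move=> sv vs ys; set t := y |: _ => H; rewrite /potential.
have wide_le : (#|[set l | wide s l]| <= #|[set l | wide t l]|)%N.
  apply/subset_leq_card/subsetP => l; rewrite !inE.
  by rewrite (wide_del sv); apply/wideS/subsetUr.
have [lt_w|ge_w] := ltnP #|[set l | wide s l]| #|[set l | wide t l]|.
  apply: leq_trans (leq_addr _ _).
  apply: leq_trans (_ : (#|[set l | wide s l]|.+1 * (M * M).+1 <= _)%N); last first.
    by rewrite leq_mul2r lt_w orbT.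
  rewrite mulSnr ltn_add2l ltnS.
  apply: (@leq_trans (\sum_(w in s) M)); first by apply: leq_sum => w _; exact: leq_subr.
  rewrite sum_nat_const leq_mul2r (leq_trans (max_card _)) ?orbT //.
  by rewrite card_prod !card_ord.
move: H; rewrite ltnNge ge_w /= => yv.
apply: leq_ltn_trans (_ : (#|[set l | wide t l]| * (M * M).+1 + \sum_(w in s) (M - code w) < _)%N).
  by rewrite leq_add2r leq_mul2r wide_le orbT.
rewrite ltn_add2l (big_setD1 v) //= [X in (_ < X)%N]big_setU1; last by rewrite !inE (negPf ys) andbF.
by rewrite /= ltn_add2r ltn_sub2l ?code_lt.
Qed.

(* If no part becomes wide, the point that replaces [v] precedes it in the
   lexicographic order, so the second term of [potential] increases. *)
Lemma toggle_potential s v y z : toggle s v -> v \in s -> y \notin s ->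
  toggle (y |: s :\ v) z -> z \in y |: s :\ v ->
  (potential s < potential (y |: s :\ v))%N.
Proof.
move=> sv vs ys tz zt; apply: potential_lt => //.
(* If no part became wide and [y] came after [v], the minimum and the earlier parts would be
   untouched, so [t] would again toggle [v]; but [t] omits [v], against [zt]. *)
set t := y |: _ in tz zt *; apply/negPn/negP; rewrite negb_or => /andP[]; rewrite -leqNgt => wle; rewrite -leqNgt => yv.
have yv' : y != v by apply: contraNneq ys => ->.
have wst : wide s =1 wide t.
  have E : [set l | wide s l] = [set l | wide t l].
    apply/eqP; rewrite eqEcard wle andbT; apply/subsetP => l; rewrite !inE.
    by rewrite (wide_del sv); apply/wideS/subsetUr.
  by move=> l; have := congr1 (fun A : {set 'I_g} => l \in A) E; rewrite !inE.
case: v sv vs yv yv' @t tz zt wst wle => l i sv vs; case: y ys => ly iy ys yv yv' t tz zt wst _.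
have lly : (l <= ly)%N.
  rewrite leqNgt; apply/negP => lyl; move: yv; rewrite /code leqNgt /=.
  apply/negP; rewrite negbK; apply: (@leq_trans (ly * n.+1 + n.+1)); first by rewrite ltn_add2l.
  by rewrite -mulSnr; apply: leq_trans (leq_addr _ _); rewrite leq_mul2r lyl orbT.
have iiy : l = ly -> (i < iy)%N.
  move=> E; subst ly; move: yv; rewrite /code leq_add2l /= leq_eqVlt => /orP[/eqP/ord_inj E|//].
  by rewrite E eqxx in yv'.
have /toggleP[/= fs [m ms mi]] := sv.
have /is_minP[m1 m2] := ms.
have nxt : (l, i) \notin t by rewrite !inE eqxx orbF eq_sym.
have lmt : (l, m) \in t.
  rewrite !inE m1 andbT; apply/orP; right; apply/eqP => -[E].
  by move: mi; rewrite -E => /eqP; rewrite ltn_eqF.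
have mt : is_min t l m.
  apply/is_minP; split=> // i'; rewrite !inE => /orP[/eqP[E ->]|/andP[_ /m2] //].
  by apply: ltnW; apply: leq_trans (iiy E); rewrite mi; exact: leqnSn.
have ft : first_active t l.
  have /first_activeP[al H] := fs; apply/first_activeP.
  have lowl : low t l.
    by apply/lowP; exists m => //; rewrite -ltnS -mi ltn_ord.
  have lowsl : low s l by apply/lowP; exists m => //; rewrite -ltnS -mi ltn_ord.
  split=> [|l' l'l]; first by rewrite -(active_eq wst) // lowl.
  rewrite -(active_eq wst) ?H //; apply: eq_existsb => i'; rewrite !inE !xpair_eqE.
  have -> : l' == ly = false by apply/eqP => E; rewrite E ltnNge lly in l'l.
  by have -> : l' == l = false by apply/eqP => E; rewrite E ltnn in l'l.
have tli : toggle t (l, i) by apply/toggleP; split=> //; exists m.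
by rewrite (toggle_uniq tz tli) (negPf nxt) in zt.
Qed.

End Toggle.

(** * The combinatorial model of the Cech complex *)

Section SpreadComplex.
Variables (g n : nat).
Local Notation V := ('I_g * 'I_n.+1)%type.
Implicit Types (s t : {set V}) (v w x y z : V) (l : 'I_g) (i : 'I_n.+1).

Definition groups s : {set 'I_g} := [set v.1 | v in s].
(** Truncated subtraction makes this the width of the part, and 0 for a part that [s] misses. *)
Definition spread s l : nat :=
  \max_(v in s | v.1 == l) \max_(w in s | w.1 == l) (w.2 - v.2).
Definition cost s : nat := \sum_l spread s l ^ 2.
Definition spread_complex (G j : nat) : {set {set V}} :=
  [set s | (s != set0) &&
     ((#|groups s| < G)%N || (#|groups s| == G) && (cost s <= j)%N)].

Lemma groupsS s t : s \subset t -> groups s \subset groups t.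
Proof. exact: imsetS. Qed.

Lemma mem_groups s l i : (l, i) \in s -> l \in groups s.
Proof. by move=> ls; apply/imsetP; exists (l, i). Qed.

Lemma spread_ge s l (i1 i2 : 'I_n.+1) : (l, i1) \in s -> (l, i2) \in s -> (i2 - i1 <= spread s l)%N.
Proof.
move=> s1 s2; rewrite /spread; apply: leq_trans (leq_bigmax_cond (l, i1) _) => /=.
  by apply: leq_trans (leq_bigmax_cond (l, i2) _); rewrite ?s2 ?eqxx.
by rewrite s1 eqxx.
Qed.

Lemma spread_le s l m : (forall i1 i2, (l, i1) \in s -> (l, i2) \in s -> (i2 - i1 <= m)%N) ->
  (spread s l <= m)%N.
Proof.
move=> H; apply/bigmax_leqP => -[a i1] /andP[s1 /eqP /= E1].
by apply/bigmax_leqP => -[b i2] /andP[s2 /eqP /= E2]; subst; apply: H.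
Qed.

Lemma spreadS s t l : s \subset t -> (spread s l <= spread t l)%N.
Proof. by move=> /subsetP st; apply: spread_le => i1 i2 /st t1 /st t2; apply: spread_ge. Qed.

Lemma costS s t : s \subset t -> (cost s <= cost t)%N.
Proof. by move=> st; apply: leq_sum => l _; rewrite leq_exp2r ?spreadS. Qed.

Lemma spread_complex_down G j s t :
  s \in spread_complex G j -> t \subset s -> t != set0 -> t \in spread_complex G j.
Proof.
rewrite !inE => /andP[_ H] ts -> /=; have gl := subset_leq_card (groupsS ts).
case/orP: H => [lt|/andP[/eqP <- cj]]; first by rewrite (leq_ltn_trans gl lt).
by rewrite (leq_trans (costS ts) cj) andbT orbC -leq_eqVlt.
Qed.

Lemma spread_ends s l : l \in groups s -> exists lo hi : 'I_n.+1,
  [/\ (l, lo) \in s, (l, hi) \in s, spread s l = (hi - lo)%N &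
      forall i, (l, i) \in s -> (lo <= i <= hi)%N].
Proof.
case/imsetP => -[l' i0] i0s /= E; subst l'.
have [lo los loP] := @arg_minnP _ i0 (fun i => (l, i) \in s) val i0s.
have [hi his hiP] := @arg_maxnP _ i0 (fun i => (l, i) \in s) val i0s.
exists lo, hi; split=> //; last by move=> i is_; rewrite loP //=; apply: hiP.
apply/eqP; rewrite eqn_leq spread_ge // andbT; apply: spread_le => i1 i2 s1 s2.
by apply: leq_sub; [apply: hiP | apply: loP].
Qed.

Lemma wide_spread s l : wide s l = (1 < spread s l)%N.
Proof.
apply/wideP/idP => [[i1 [i2 [s1 s2 i12]]]|].
  by apply: leq_trans (spread_ge s1 s2); rewrite ltn_subRL addn1.
have [lg|lg] := boolP (l \in groups s); last first.
  move=> H; suff : (spread s l <= 0)%N by rewrite leqNgt (ltn_trans _ H).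
  by apply: spread_le => i1 i2 /mem_groups; rewrite (negPf lg).
have [lo [hi [slo shi -> _]]] := spread_ends lg.
by rewrite ltn_subRL addn1 => lh; exists lo, hi.
Qed.

Lemma spread_notin s l : l \notin groups s -> spread s l = 0%N.
Proof.
move=> lg; apply/eqP; rewrite -leqn0.
by apply: spread_le => i1 i2 /mem_groups; rewrite (negPf lg).
Qed.

Lemma card_part s l : ~~ wide s l ->
  #|[set v in s | v.1 == l]| = ((l \in groups s) + spread s l ^ 2)%N.
Proof.
rewrite wide_spread -leqNgt => sp1; have [lg|lg] := boolP (l \in groups s); last first.
  transitivity 0%N; last by rewrite spread_notin.
  apply/eqP; rewrite cards_eq0; apply/eqP/setP => -[l' i]; rewrite !inE; apply/negP => /andP[ls /eqP /= E].
  by subst l'; rewrite (mem_groups ls) in lg.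
have [lo [hi [slo shi E H]]] := spread_ends lg.
have lohi : (lo <= hi)%N by have /andP[] := H _ slo.
case: (eqVneq lo hi) => [lh|lh].
  rewrite E -lh subnn /= addn0 (_ : [set _ in _ | _] = [set (l, lo)]) ?cards1 //.
  apply/setP => -[l' i]; rewrite !inE xpair_eqE andbC.
  case: (eqVneq l' l) => //= ->; apply/idP/eqP => [/H|-> //].
  by rewrite -lh -eqn_leq => /eqP/ord_inj.
have E1 : hi = lo.+1 :> nat.
  have : (lo : nat) != hi by apply: contra lh => /eqP/ord_inj ->.
  move: sp1; rewrite E; lia.
rewrite E E1 subSnn /= (_ : [set _ in _ | _] = [set (l, lo); (l, hi)]).
  by rewrite cards2 xpair_eqE eqxx lh.
apply/setP => -[l' i]; rewrite !inE !xpair_eqE andbC.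
case: (eqVneq l' l) => //= ->; apply/idP/orP => [/H|[/eqP->|/eqP->] //].
rewrite E1; case/andP=> lo_i; rewrite leq_eqVlt => /orP[/eqP i1|i1].
  by right; apply/eqP/ord_inj; rewrite i1 E1.
by left; apply/eqP/ord_inj/eqP; rewrite eqn_leq lo_i andbT.
Qed.

(** Widths 0 and 1 equal their squares, so [cost] counts the second points of the parts. Cardinality
    and number of parts thus determine the cost of a narrow face. *)
Lemma card_narrow s : ~~ some_wide s -> #|s| = (#|groups s| + cost s)%N.
Proof.
move=> /existsPn nw; rewrite -sum1_card (partition_big fst predT) //=.
rewrite -[X in (X + _)%N]sum1_card [X in (X + _)%N]big_mkcond /= -big_split; apply: eq_bigr => l _.
transitivity #|[set v in s | v.1 == l]|; last by rewrite card_part //; case: (l \in _).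
by rewrite sum1dep_card.
Qed.

Definition top : {set V} := [set v : V | v.2 == n :> nat].

(** A wide part also contains an index below [n], so in both cases the minimum of the first active
    part has a successor. *)
Lemma toggle_exists s : ~~ (s \subset top) -> exists v, toggle s v.
Proof.
case/subsetPn => -[l i] ls; rewrite inE /= => inn.
have [l' al'] : exists l', active s l'.
  rewrite /active; have [ws|_] := boolP (some_wide s).
    by have /existsP[l' wl'] : [exists l', wide s l'] := ws; exists l'.
  exists l; apply/lowP; exists i => //.
  by rewrite ltn_neqAle inn -ltnS ltn_ord.
have [l0 fl0] := ex_first_active al'.
have /lowP[i0 i0s i0n] : low s l0.
  have /first_activeP[] := fl0; rewrite /active; case: ifP => // _ /wideP[i1 [i2 [s1 _ H]]] _.
  by apply/lowP; exists i1 => //; have := ltn_ord i2; lia.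
have [m mm] := ex_min i0s.
have mn : (m.+1 < n.+1)%N by have /is_minP[_ /(_ _ i0s) H] := mm; rewrite ltnS (leq_ltn_trans H).
exists (l0, Ordinal mn); apply/toggleP; split=> //; by exists m.
Qed.

Lemma toggle_groups s v : toggle s v -> groups (v |: s) = groups s.
Proof.
case: v => l i /toggleP[/= _ [m /is_minP[ms _] _]].
apply/eqP; rewrite eqEsubset; apply/andP; split; last exact/groupsS/subsetUr.
by rewrite /groups imsetU imset_set1 subUset subxx andbT sub1set; apply: mem_groups ms.
Qed.

Lemma some_wide_add s v : toggle s v -> some_wide (v |: s) = some_wide s.
Proof.
move=> sv; apply: eq_existsb => l; apply/esym; apply: (wide_off _ sv) => w wv.
by rewrite !inE (negPf wv).
Qed.

(** The toggled point lies strictly between the ends of a wide part. *)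
Lemma cost_add_wide s v : toggle s v -> some_wide s -> cost (v |: s) = cost s.
Proof.
case: v => l i sv ws; apply: eq_bigr => l' _; congr (_ ^ _)%N.
apply/eqP; rewrite eqn_leq [X in _ && X]spreadS ?subsetUr // andbT.
have /toggleP[/= fs [m /is_minP[ms mP] mi]] := sv.
have /first_activeP[+ _] := fs; rewrite /active ws => /wideP[i1 [i2 [s1 s2 i12]]].
have M1 := mP _ s1.
apply: spread_le => j1 j2; rewrite !inE !xpair_eqE.
case: (eqVneq l' l) => [->|_] /=; last by move=> t1 t2; apply: spread_ge.
case/orP=> [/eqP->|t1]; case/orP=> [/eqP->|t2].
- by rewrite subnn.
- by apply: leq_trans (spread_ge ms t2); rewrite mi leq_sub2l.
- by apply: leq_trans (spread_ge t1 s2); apply: leq_sub2r; rewrite mi (leq_trans _ (ltnW i12)).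
- exact: spread_ge.
Qed.

(** Both sets are narrow and meet the same parts, so [card_narrow] turns the extra point into a unit
    of cost. *)
Lemma cost_add_narrow s v : toggle s v -> ~~ some_wide s -> v \notin s ->
  cost (v |: s) = (cost s).+1.
Proof.
move=> sv nw vs; have := card_narrow nw; have : ~~ some_wide (v |: s) by rewrite some_wide_add.
move/card_narrow; rewrite cardsU1 vs toggle_groups //; lia.
Qed.

Lemma top_groups s : s \subset top -> #|groups s| = #|s|.
Proof.
move=> /subsetP st; apply: card_in_imset => -[l i] [l' i'] /st + /st.
by rewrite !inE /= => /eqP iE /eqP i'E ->; congr pair; apply: ord_inj; rewrite iE.
Qed.

End SpreadComplex.

(** * Critical faces *)

Section CriticalFaces.
Variables (g n G j : nat).
Hypothesis G_gt0 : (0 < G)%N.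
Local Notation V := ('I_g * 'I_n.+1)%type.
Local Notation K := (@spread_complex g n G j).
Local Notation crit := (critical (@toggle g n) K).
Implicit Types (s t : {set V}) (v w x y z : V) (l : 'I_g) (i : 'I_n.+1).

Lemma mem_complex0 s : (s \in set0 |: K) =
  (#|groups s| < G)%N || (#|groups s| == G) && (cost s <= j)%N.
Proof.
rewrite !inE; case: eqVneq => [->|//]; rewrite /= /groups imset0 cards0.
by rewrite G_gt0.
Qed.

(** Adding the toggled vertex keeps the parts met, so it leaves the complex only by raising the cost
    above [j]. That requires a narrow face with [G] parts and cost [j]. *)
Lemma critical_cases m s : s \in crit m -> s \subset top g n \/
  [/\ #|groups s| = G, ~~ some_wide s, cost s = j & exists2 v, toggle s v & v \notin s].
Proof.
rewrite inE facesP => /andP[/andP[sK _] nE].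
have [|/toggle_exists[v sv]] := boolP (s \subset top g n); [by left | right].
have : ~~ ((v \in s) || (v |: s \in K)).
  by apply: contra nE => H; apply/existsP; exists v; rewrite sv.
rewrite negb_or => /andP[vs vK].
have : v |: s \notin set0 |: K.
  by rewrite in_setU1 negb_or vK andbT -card_gt0 cardsU1 vs.
move: sK; rewrite !mem_complex0 toggle_groups //.
case: ltnP => //= _ /andP[/eqP gG cj]; rewrite gG eqxx /= -ltnNge => jc.
have [ws|nw] := boolP (some_wide s).
  by rewrite cost_add_wide // ltnNge cj in jc.
rewrite cost_add_narrow // ltnS in jc.
by split=> //; [apply/eqP; rewrite eqn_leq cj jc | exists v].
Qed.

(** The second alternative of [critical_cases] forces cardinality [G + j]; what remains are subsets
    of the [g] top points. *)
Lemma card_critical_other m : m != (G + j)%N -> (#|crit m| <= 2 ^ g)%N.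
Proof.
move=> mn; have -> : (2 ^ g = #|powerset (top g n)|)%N.
  rewrite card_powerset; congr (_ ^ _)%N.
  have -> : top g n = setX setT [set ord_max].
    by apply/setP => -[l i]; rewrite !inE.
  by rewrite cardsX cards1 muln1 cardsT card_ord.
apply/subset_leq_card/subsetP => s sc; rewrite inE.
case: (critical_cases sc) => // -[gG nw cj _].
move: sc; rewrite inE facesP => /andP[/andP[_ /eqP sm]].
by rewrite -sm card_narrow // gG cj eqxx in mn.
Qed.

Lemma critical_intro s v : ~~ some_wide s -> toggle s v -> v \notin s ->
  #|groups s| = G -> cost s = j -> s \in crit (G + j).
Proof.
move=> nw sv vs gG cj; rewrite inE facesP mem_complex0 gG cj eqxx leqnn orbT /=.
rewrite card_narrow // gG cj eqxx /=.
apply/existsPn => w; apply/negP => /andP[sw]; rewrite -(toggle_uniq sv sw) (negPf vs) /= => vK.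
have : v |: s \in set0 |: K by rewrite in_setU1 vK orbT.
by rewrite mem_complex0 toggle_groups // gG ltnn eqxx cost_add_narrow // cj ltnn.
Qed.

End CriticalFaces.

(** * Critical faces for cost 0 *)

Section Transversals.
Variables (g n : nat).
Local Notation V := ('I_g * 'I_n.+1)%type.
Implicit Types (s t : {set V}) (v w x y z : V) (l : 'I_g) (i : 'I_n.+1).

Definition transversals (G : nat) : {set {set V}} :=
  [set s : {set V} | (#|s| == G) && (#|groups s| == G)].

Lemma transversal_inj G s : s \in transversals G -> {in s &, injective fst}.
Proof.
by rewrite inE => /andP[/eqP sG /eqP gG]; apply/imset_injP; rewrite -/(groups s) gG sG.
Qed.

Lemma transversal_narrow G s : s \in transversals G -> ~~ some_wide s.
Proof.
move=> /transversal_inj inj; apply/existsPn => l; apply/wideP => -[i1 [i2 [s1 s2]]].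
by have [->] := inj _ _ s1 s2 erefl; rewrite ltnNge leqnSn.
Qed.

(** A set of [G] top points is itself a transversal, so the count is exact here. Conversely, the
    toggled vertex of a transversal would be a second point of its part, hence is absent. *)
Lemma critical_transversals G : (0 < G)%N ->
  critical (@toggle g n) (spread_complex g n G 0) G = transversals G.
Proof.
move=> G0; apply/setP => s; apply/idP/idP => [sc|st].
  have sG : #|s| = G by move: sc; rewrite inE facesP => /andP[/andP[_ /eqP]].
  rewrite inE sG eqxx /=; case: (critical_cases G0 sc) => [|[-> //]].
  by move/top_groups => ->; rewrite sG.
have nw := transversal_narrow st; have inj := transversal_inj st.
move: (st); rewrite inE => /andP[/eqP sG /eqP gG].
have c0 : cost s = 0%N by have := card_narrow nw; lia.
have [/existsP[v sv]|/existsPn nE] := boolP [exists v, toggle s v].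
  rewrite -[X in critical _ _ X]addn0; apply: (critical_intro G0 nw sv) => //.
  case: v sv => l i sv; have /toggleP[/= _ [m /is_minP[ms _] mi]] := sv.
  apply/negP => vs; have [E] := inj _ _ vs ms erefl.
  by move: mi; rewrite E => /eqP; rewrite ltn_eqF.
rewrite inE facesP mem_complex0 // gG sG c0 eqxx ltnn /=.
by apply/existsPn => v; rewrite (negPf (nE v)).
Qed.

Definition graph_over (D : {set 'I_g}) (f : {ffun 'I_g -> 'I_n.+1}) : {set V} :=
  [set (l, f l) | l in D].

Lemma graph_over_groups D f : groups (graph_over D f) = D.
Proof. by rewrite /groups /graph_over -imset_comp imset_id. Qed.

(** Transversals over [D] correspond to functions equal to the default [ord0] outside [D]; fixing
    this default makes the graph determine the function. *)
Lemma card_transversals_over (D : {set 'I_g}) :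
  #|[set s in transversals #|D| | groups s == D]| = (n.+1 ^ #|D|)%N.
Proof.
have -> : [set s in transversals #|D| | groups s == D] =
  [set graph_over D f | f in pffun_on ord0 D predT].
  apply/setP => s; rewrite inE; apply/andP/imsetP => [[st /eqP gD]|[f _ ->]]; last first.
    rewrite inE graph_over_groups !eqxx /graph_over card_imset ?eqxx //.
    by move=> a b [].
  pose f := [ffun l => odflt ord0 [pick i | (l, i) \in s]].
  have fP l i : (l, i) \in s -> f l = i.
    move=> ls; rewrite ffunE; case: pickP => [i' /= i's|/(_ i)]; last by rewrite ls.
    by have [] := transversal_inj st i's ls erefl.
  exists f.
    apply/pffun_onP; split=> //; apply/subsetP => l; rewrite inE ffunE -gD.
    by case: pickP => [i /mem_groups //|_]; rewrite eqxx.
  apply/setP => -[l i]; apply/idP/imsetP => [ls|[l' l'D [-> ->]]].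
    by exists l; [rewrite -gD; apply: mem_groups ls | rewrite (fP _ _ ls)].
  by move: l'D; rewrite -gD => /imsetP[[a b] abs /= ->]; rewrite (fP _ _ abs).
rewrite card_in_imset ?card_pffun_on; first by rewrite card_ord.
move=> f1 f2 /pffun_onP[d1 _] /pffun_onP[d2 _] E; apply/ffunP => l.
have [lD|lD] := boolP (l \in D).
  have : (l, f1 l) \in graph_over D f2 by rewrite -E; apply/imsetP; exists l.
  by case/imsetP => l' _ [-> ->].
have out (f : {ffun 'I_g -> 'I_n.+1}) : ord0.-support f \subset D -> f l = ord0.
  by move=> /subsetP d; apply/eqP; apply: contraNT lD => H; apply: d; rewrite inE.
by rewrite !out.
Qed.

Lemma card_transversals G : #|transversals G| = ('C(g, G) * n.+1 ^ G)%N.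
Proof.
rewrite -sum1_card (partition_big (@groups g n) (fun D => #|D| == G)) => [|s]; last first.
  by rewrite inE => /andP[].
rewrite -[X in 'C(X, G)]card_ord -card_draws -sum1_card big_distrl /=.
rewrite [RHS](eq_bigl (fun D : {set 'I_g} => #|D| == G)); last by move=> D; rewrite inE.
apply: eq_bigr => D /eqP DG; rewrite mul1n -DG -card_transversals_over -sum1_card.
by apply: eq_bigl => s; rewrite [in RHS]inE.
Qed.

End Transversals.

(** * Critical faces meeting every part *)

Section Staircases.
Variables (g' n j : nat).
Local Notation g := g'.+1.
Local Notation V := ('I_g * 'I_n.+1)%type.
Local Notation stair_data := ({ffun 'I_g -> 'I_n.+1} * {set 'I_g})%type.
Implicit Types (s t : {set V}) (v w x y z : V) (l : 'I_g) (i : 'I_n.+1).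
Implicit Types (f : {ffun 'I_g -> 'I_n.+1}) (B : {set 'I_g}).

(** Different data can give the same set when [p.1 l = n], where the successor index does not exist;
    injectivity is therefore stated on [generic_data]. *)
Definition staircase (p : stair_data) : {set V} :=
  [set v : V | (v.2 == p.1 v.1 :> nat) || (v.1 \in p.2) && (v.2 == (p.1 v.1).+1 :> nat)].

Definition below_top : {set {ffun 'I_g -> 'I_n.+1}} := [set f : {ffun 'I_g -> 'I_n.+1} | [forall l, (f l < n)%N]].
(** Part [ord0] is then the first low part, and the successor of its minimum is the toggled point;
    it must be absent from a critical face, so [ord0] is kept out of [B]. *)
Definition generic_data : {set stair_data} :=
  setX below_top [set B : {set 'I_g} | B \subset ~: [set ord0] & #|B| == j].
(** An overestimate of the other critical faces; for fixed [g'] its size is only of order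
    [n ^ g']. *)
Definition boundary_data : {set stair_data} := setX (~: below_top) setT.

Lemma below_topP f l : f \in below_top -> (f l < n)%N.
Proof. by rewrite inE => /forallP. Qed.

Lemma staircase_min f B l : is_min (staircase (f, B)) l (f l).
Proof.
apply/is_minP; rewrite inE eqxx; split=> // i; rewrite inE /=.
by case/orP=> [/eqP->|/andP[_ /eqP->]].
Qed.

Lemma staircase_groups f B : #|groups (staircase (f, B))| = g.
Proof.
rewrite -[RHS]card_ord; apply: eq_card => l; rewrite !inE.
by apply: (@mem_groups _ _ _ _ (f l)); have /is_minP[] := staircase_min f B l.
Qed.

Lemma staircase_spread f B l : (f l < n)%N -> spread (staircase (f, B)) l = (l \in B).
Proof.
move=> fn; apply/eqP; rewrite eqn_leq; apply/andP; split.
  apply: spread_le => i1 i2; rewrite !inE /=.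
  by case: (l \in B) => /=; lia.
case: (boolP (l \in B)) => // lB.
have fn1 : ((f l).+1 < n.+1)%N by [].
apply: leq_trans (spread_ge (i1 := f l) (i2 := Ordinal fn1) _ _); rewrite ?inE /= ?eqxx //.
  by rewrite subSnn.
by rewrite lB orbT.
Qed.

Lemma staircase_cost f B : f \in below_top -> cost (staircase (f, B)) = #|B|.
Proof.
move=> fb; rewrite -sum1_card big_mkcond; apply: eq_bigr => l _.
by rewrite staircase_spread ?below_topP //; case: (l \in B).
Qed.

Lemma staircase_narrow f B : f \in below_top -> ~~ some_wide (staircase (f, B)).
Proof.
move=> fb; apply/existsPn => l; rewrite wide_spread staircase_spread ?below_topP //.
by case: (l \in B).
Qed.

Lemma toggle_low0 s i : ~~ some_wide s -> is_min s ord0 i -> (i < n)%N ->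
  exists2 v, toggle s v & v = (ord0, inord i.+1).
Proof.
move=> nw mi i_n; exists (ord0, inord i.+1) => //; apply/toggleP => /=; split.
  apply/first_activeP; split=> // ; rewrite /active (negPf nw).
  by apply/lowP; exists i => //; case/is_minP: mi.
by exists i => //; rewrite inordK.
Qed.

Lemma generic_critical p : p \in generic_data ->
  staircase p \in critical (@toggle g n) (spread_complex g n g j) (g + j).
Proof.
case: p => f B /setXP[/= fb]; rewrite inE => /andP[/subsetP B0 /eqP Bj].
have f0 := below_topP ord0 fb.
have [v sv vE] := toggle_low0 (staircase_narrow B fb) (staircase_min f B ord0) f0.
apply: (critical_intro _ (staircase_narrow B fb) sv) => //.
- rewrite vE inE /= inordK // negb_or neq_ltn ltnSn orbT /= eqxx andbT.
  by apply/negP => /B0; rewrite !inE eqxx.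
- exact: staircase_groups.
- by rewrite staircase_cost.
Qed.

Lemma staircase_inj : {in generic_data &, injective staircase}.
Proof.
move=> [f B] [f' B'] /setXP[/= fb _] _ E.
have ff : f = f'.
  apply/ffunP => l; apply: (is_min_uniq (staircase_min f B l)).
  by rewrite E; apply: staircase_min.
subst f'; congr pair; apply/setP => l.
have := staircase_spread B (below_topP l fb).
by rewrite E staircase_spread ?below_topP //; case: (l \in B); case: (l \in B').
Qed.

(** A narrow set meeting every part consists, in each part, of a minimum and possibly its successor.
    The hypothesis [0 < j] excludes sets of top points, which have at most [g] elements. *)
Lemma critical_staircase s : (0 < j)%N ->
  s \in critical (@toggle g n) (spread_complex g n g j) (g + j) ->
  s \in staircase @: (generic_data :|: boundary_data).
Proof.
move=> j0 sc; have sj : #|s| = (g + j)%N by move: sc; rewrite inE facesP => /andP[/andP[_ /eqP]].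
case: (critical_cases _ sc) => // [/top_groups E|[gG nw cj [v sv vs]]].
  have : (#|groups s| <= g)%N by rewrite -[X in (_ <= X)%N]card_ord max_card.
  by lia.
have all_groups l : l \in groups s.
  suff -> : groups s = setT by rewrite inE.
  by apply/eqP; rewrite eqEcard subsetT cardsT card_ord gG leqnn.
pose f := [ffun l => odflt ord0 [pick i | is_min s l i]].
have fP l : is_min s l (f l).
  rewrite ffunE; case: pickP => //= noi.
  by have /imsetP[[l' i] /ex_min[m /= mm] /= E] := all_groups l; have := noi m; rewrite E mm.
(* The condition [f l < n] keeps [inord] from returning its default value at [n.+1]. *)
pose B := [set l | (l, inord (f l).+1) \in s & (f l < n)%N].
have sE : s = staircase (f, B).
  apply/setP => -[l i]; rewrite !inE /=; have /is_minP[fs fm] := fP l.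
  apply/idP/idP => [ls|/orP[/eqP/ord_inj->//|/andP[/andP[ls fn] /eqP iE]]]; last first.
    by rewrite (_ : i = inord (f l).+1) //; apply: ord_inj; rewrite inordK // -iE.
  have := fm _ ls; rewrite leq_eqVlt => /predU1P[->|fi]; first by rewrite eqxx.
  have /eqP iE : i == (f l).+1 :> nat.
    rewrite eqn_leq fi andbT leqNgt; apply/negP => fi1.
    by move/existsPn/(_ l)/wideP: nw; apply; exists (f l), i.
  have fn : (f l < n)%N by rewrite -ltnS -iE.
  by rewrite fn iE eqxx (_ : inord _ = i) ?ls ?orbT //; apply: ord_inj; rewrite inordK // ltnS.
apply/imsetP; exists (f, B) => //; rewrite in_setU !in_setX in_setT in_setC /=.
case fb : (f \in below_top) => //=; rewrite orbF.
have f0 := below_topP ord0 fb.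
have [w sw wE] := toggle_low0 nw (fP ord0) f0.
rewrite inE -cj [X in cost X]sE staircase_cost // eqxx andbT.
(* Were [ord0] in [B], the toggled vertex would belong to [s], against [vs]. *)
apply/subsetP => l lB; rewrite !inE; apply: contraNneq vs => l0; subst l.
by move: lB; rewrite inE (toggle_uniq sv sw) wE => /andP[].
Qed.

Lemma card_below_top : #|below_top| = (n ^ g)%N.
Proof.
have nE : #|[pred i : 'I_n.+1 | (i < n)%N]| = n.
  rewrite -[RHS]card_ord -(card_imset _ (@lift_inj n.+1 ord_max)).
  apply: eq_card => i; rewrite inE; apply/idP/imsetP => [i_n|[k _ ->]]; last by rewrite lift_max.
  by exists (Ordinal i_n) => //; apply: ord_inj; rewrite lift_max.
transitivity (#|[pred i : 'I_n.+1 | (i < n)%N]| ^ #|'I_g|)%N; last by rewrite nE card_ord.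
rewrite -card_ffun_on; apply: eq_card => f; rewrite inE.
by apply/forallP/ffun_onP => H l; have := H l; rewrite inE.
Qed.

Lemma card_generic_data : #|generic_data| = (n ^ g * 'C(g', j))%N.
Proof.
by rewrite cardsX card_below_top cards_draws cardsC1 card_ord.
Qed.

Lemma card_boundary_data : #|boundary_data| = ((n.+1 ^ g - n ^ g) * 2 ^ g)%N.
Proof.
rewrite cardsX cardsCs setCK card_below_top card_ffun !card_ord.
have -> : [set: {set 'I_g}] = powerset setT by apply/setP => B; rewrite !inE subsetT.
by rewrite card_powerset cardsT card_ord.
Qed.

End Staircases.

(** * Betti numbers of complexes isomorphic to the model *)

Section Transport.
Variables (F : fieldType) (T : finType) (g n G j : nat).
Local Notation V := ('I_g * 'I_n.+1)%type.
Local Notation KV := (spread_complex g n G j).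
Variables (h : T -> V) (K : {set {set T}}).
Hypotheses (h_bij : bijective h) (G_gt0 : (0 < G)%N).
Hypothesis KE : forall s : {set T}, (s \in K) = (h @: s \in KV).
Implicit Types (s t : {set T}) (x y z : T).

Let h_inj : injective h := bij_inj h_bij.

Let togT s x := toggle (h @: s) (h x).

Let imset_add s x : h @: (x |: s) = h x |: h @: s.
Proof. by rewrite imsetU imset_set1. Qed.

Let imset_del s x : h @: (s :\ x) = h @: s :\ h x.
Proof.
have [f hK fK] := h_bij; apply/setP => v; rewrite -[v]fK.
by rewrite !inE !mem_imset // !inE inj_eq.
Qed.

Let K_down : down_closed K.
Proof.
move=> s t; rewrite !KE => sK ts t0; apply: spread_complex_down sK _ _.
  exact: imsetS.
by apply: contra t0; rewrite imset_eq0.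
Qed.

Let critical_transport m : #|critical togT K m| = #|critical (@toggle g n) KV m|.
Proof.
have imI : injective (fun s => h @: s) by apply: imset_inj.
rewrite -(card_imset _ imI); apply: eq_card => s.
have critE (t : {set T}) : (t \in critical togT K m) =
    (h @: t \in critical (@toggle g n) KV m).
  rewrite [LHS]inE [RHS]inE !facesP card_imset // !in_setU1 KE imset_eq0.
  congr (_ && ~~ _); have [f hK fK] := h_bij.
  apply/existsP/existsP => [[x Hx]|[v Hv]].
    by exists (h x); rewrite mem_imset // -imset_add -KE.
  by exists (f v); rewrite /togT fK KE imset_add fK -{2}[v]fK (mem_imset _ _ h_inj) in Hv *.
apply/imsetP/idP => [[t tc ->]|sc]; first by rewrite -critE.
have [f hK fK] := h_bij.
have sE : s = h @: (f @: s) by rewrite -imset_comp -[LHS]imset_id; apply: eq_imset => v /=.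
by exists (f @: s); rewrite ?critE -?sE.
Qed.

(** The matching is pulled back along [h]. The two error terms bound the critical faces in the
    adjacent dimensions by [card_critical_other]. *)
Lemma betti_spread_bounds p : (p.+1 = G + j)%N ->
  let c := #|critical (@toggle g n) KV (G + j)| in
  (reduced_betti F K p <= c)%N /\ (c <= reduced_betti F K p + 2 ^ g + 2 ^ g)%N.
Proof.
move=> pE c.
have [||||ub lb] := @betti_bounds T togT (fun s => potential (h @: s)) _ _ _ _ F K p K_down.
- by move=> s x y sx sy; apply/h_inj/(toggle_uniq sx).
- by move=> s x sx xs; rewrite /togT imset_del toggle_del // mem_imset.
- by move=> s x sx xs; rewrite /togT imset_add toggle_add // mem_imset.
- move=> s x y z sx xs ys; rewrite /togT -(mem_imset _ _ h_inj) imset_add imset_del.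
  by apply: toggle_potential; rewrite ?mem_imset.
rewrite !critical_transport pE in ub lb; rewrite -/c in ub lb.
have c1 := @card_critical_other g n G j G_gt0 p.
have c2 := @card_critical_other g n G j G_gt0 (G + j).+1.
split=> //; apply: leq_trans lb _; rewrite -!addnA leq_add2l.
by apply: leq_add; [apply: c1 | apply: c2]; lia.
Qed.

End Transport.

Section SpreadBetti.
Variables (F : fieldType) (T : finType) (k n : nat).
Variables (h : T -> 'I_k.+1 * 'I_n.+1) (K : {set {set T}}).
Hypothesis h_bij : bijective h.

Lemma betti_spread_low p :
  (forall s : {set T}, (s \in K) = (h @: s \in spread_complex k.+1 n p.+1 0)) ->
  (reduced_betti F K p <= 'C(k.+1, p.+1) * n.+1 ^ p.+1)%N /\
  ('C(k.+1, p.+1) * n.+1 ^ p.+1 <= reduced_betti F K p + 2 ^ k.+2)%N.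
Proof.
move=> KE; have := betti_spread_bounds F h_bij (ltn0Sn p) KE (esym (addn0 _)).
by rewrite addn0 critical_transversals // card_transversals -addnA addnn -mul2n -expnS.
Qed.

(** The upper bound counts generic and boundary data; the lower bound uses the generic staircases,
    which are critical and pairwise distinct. *)
Lemma betti_spread_high j : (0 < j)%N ->
  (forall s : {set T}, (s \in K) = (h @: s \in spread_complex k.+1 n k.+1 j)) ->
  (reduced_betti F K (k + j) <= n ^ k.+1 * 'C(k, j) + (n.+1 ^ k.+1 - n ^ k.+1) * 2 ^ k.+1)%N /\
  (n ^ k.+1 * 'C(k, j) <= reduced_betti F K (k + j) + 2 ^ k.+2)%N.
Proof.
move=> j0 KE; have [ub lb] := betti_spread_bounds F h_bij (ltn0Sn k) KE (esym (addSn _ _)).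
split.
  apply: leq_trans ub _; rewrite -card_generic_data -card_boundary_data.
  apply: leq_trans (leq_card_setU _ _).
  apply: leq_trans (leq_imset_card (@staircase k n) _).
  by apply/subset_leq_card/subsetP => s; apply: critical_staircase.
move: lb; rewrite -addnA addnn -mul2n -expnS; apply: leq_trans.
rewrite -card_generic_data -(card_in_imset (@staircase_inj k n j)).
by apply/subset_leq_card/subsetP => s /imsetP[p pg ->]; apply: generic_critical.
Qed.

End SpreadBetti.

(** * Enclosing balls *)

Section Variance.
Variables (R : realType) (d : nat).
Implicit Types (x y : 'rV[R]_d).

Definition sqnorm x : R := \sum_i x 0 i ^+ 2.

Lemma sqnorm_ge0 x : 0 <= sqnorm x.
Proof. by apply: sumr_ge0 => i _; apply: sqr_ge0. Qed.

Lemma sqnormB x y : sqnorm (x - y) = sqnorm (y - x).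
Proof. by apply: eq_bigr => i _; rewrite !mxE -sqrrN opprB. Qed.

Lemma enorm_le x r : 0 <= r -> (enorm x <= r) = (sqnorm x <= r ^+ 2).
Proof.
by move=> r0; rewrite /enorm -{1}(ger0_norm r0) -sqrtr_sqr ler_sqrt ?sqr_ge0.
Qed.

Variables (I : finType) (w : I -> R).
Hypothesis w1 : \sum_i w i = 1.

Lemma variance_identity_real (p : I -> R) (a : R) :
  \sum_i w i * (a - p i) ^+ 2 = (a - \sum_i w i * p i) ^+ 2 +
    2^-1 * \sum_i \sum_j w i * w j * (p i - p j) ^+ 2.
Proof.
set c := \sum_i w i * p i; pose q := \sum_i w i * p i ^+ 2.
have -> : \sum_i w i * (a - p i) ^+ 2 = a ^+ 2 - 2 * a * c + q.
  transitivity (\sum_i (a ^+ 2 * w i - 2 * a * (w i * p i) + w i * p i ^+ 2)).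
    by apply: eq_bigr => i _; ring.
  by rewrite big_split sumrB /= -!mulr_sumr w1 mulr1.
have -> : \sum_i \sum_j w i * w j * (p i - p j) ^+ 2 = 2 * q - 2 * c ^+ 2.
  transitivity (\sum_i (w i * p i ^+ 2 - 2 * c * (w i * p i) + q * w i)).
    apply: eq_bigr => i _.
    transitivity (\sum_j ((w i * p i ^+ 2) * w j - (2 * w i * p i) * (w j * p j) +
                          w i * (w j * p j ^+ 2))).
      by apply: eq_bigr => j _; ring.
    by rewrite big_split sumrB /= -!mulr_sumr w1 -/c -/q; ring.
  by rewrite big_split sumrB /= -!mulr_sumr w1 -/c -/q; ring.
by field.
Qed.

(** The parallel axis formula. With [x] the center of a ball it bounds the radius from below; with
    [x] a point of the set it gives the distance from that point to the weighted mean. *)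
Lemma variance_identity (p : I -> 'rV[R]_d) x :
  \sum_i w i * sqnorm (x - p i) = sqnorm (x - \sum_i w i *: p i) +
    2^-1 * \sum_i \sum_j w i * w j * sqnorm (p i - p j).
Proof.
transitivity (\sum_m \sum_i w i * (x 0 m - p i 0 m) ^+ 2).
  rewrite exchange_big; apply: eq_bigr => i _; rewrite mulr_sumr.
  by apply: eq_bigr => m _; rewrite !mxE.
under eq_bigr => m _ do rewrite (variance_identity_real (fun i => p i 0 m)).
rewrite big_split /=; congr (_ + _).
  apply: eq_bigr => m _; rewrite !mxE summxE.
  by under [in RHS]eq_bigr => i _ do rewrite mxE.
rewrite -mulr_sumr exchange_big; congr (_ * _); apply: eq_bigr => i _.
rewrite exchange_big; apply: eq_bigr => j _; rewrite mulr_sumr.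
by apply: eq_bigr => m _; rewrite !mxE.
Qed.

End Variance.

(** * Circumradius estimates for points on several arcs *)

Section EnclosingBall.
Variables (R : realType) (d k n : nat).
Local Notation g := k.+1.
Local Notation V := ('I_g * 'I_n.+1)%type.
Variables (P : V -> 'rV[R]_d) (om : nat -> R) (eps h : R).
Implicit Types (s : {set V}) (l : 'I_g).

Hypothesis cross_ge : forall v w : V, v.1 != w.1 -> 1 <= sqnorm (P v - P w).
Hypothesis cross_le : forall v w : V, v.1 != w.1 -> sqnorm (P v - P w) <= 1 + eps.
Hypothesis arc_dist : forall l (i i' : 'I_n.+1), (i <= i')%N ->
  sqnorm (P (l, i) - P (l, i')) = om (i' - i).
Hypothesis om_superadd : forall a b, (a + b <= n)%N -> om a + om b <= om (a + b).
Hypothesis om_ge0 : forall a, 0 <= om a.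
Hypothesis eps_ge0 : 0 <= eps.

Definition enclosed s (q : R) := exists x, forall v, v \in s -> sqnorm (x - P v) <= q.

Section Weights.
Variables (lo hi : 'I_g -> 'I_n.+1) (mu : 'I_g -> R).
Hypothesis lohi : forall l, (lo l <= hi l)%N.
Hypotheses (mu_ge0 : forall l, 0 <= mu l) (mu1 : \sum_l mu l = 1).

Let W l := om (hi l - lo l).
(** The weight [mu l] of a part is split equally between its two ends. *)
Let node (e : 'I_g * bool) : V := (e.1, if e.2 then hi e.1 else lo e.1).
Let wt (e : 'I_g * bool) : R := mu e.1 / 2.

Let sum_nodes (f : 'I_g * bool -> R) : \sum_e f e = \sum_l (f (l, true) + f (l, false)).
Proof.
rewrite (eq_bigr (fun e => f (e.1, e.2))) => [|[] //].
rewrite -(pair_bigA _ (fun l b => f (l, b))); apply: eq_bigr => l _ /=.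
by rewrite big_bool.
Qed.

Lemma node_weights_sum : \sum_e wt e = 1.
Proof. by rewrite sum_nodes -mu1; apply: eq_bigr => l _; rewrite /wt /=; field. Qed.

(** Pairs of nodes in different parts, at squared distance at least 1, give the first term; the two
    ends of a single part give the second. *)
Lemma nodes_variance_ge :
  2^-1 * (1 - \sum_l mu l ^+ 2) + 4^-1 * \sum_l mu l ^+ 2 * W l <=
  2^-1 * \sum_e \sum_e' wt e * wt e' * sqnorm (P (node e) - P (node e')).
Proof.
have -> : 1 - \sum_l mu l ^+ 2 = \sum_l \sum_(l' | l' != l) mu l * mu l'.
  apply/eqP; rewrite subr_eq -big_split /= -[X in X == _](mulr1 1) -{1}mu1 mulr_suml.
  apply/eqP/eq_bigr => l _; rewrite -mu1 mulr_sumr (bigD1 l) //= addrC.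
  by rewrite -expr2.
have -> : 4^-1 * \sum_l mu l ^+ 2 * W l = 2^-1 * \sum_l (mu l ^+ 2 * W l / 2).
  by rewrite -mulr_suml; field.
rewrite -mulrDr -big_split ler_pM2l ?invr_gt0 //=.
rewrite sum_nodes; apply: ler_sum => l _.
rewrite !sum_nodes -big_split [X in _ <= X](bigD1 l) //= addrC.
have dist0 v : sqnorm (P v - P v) = 0 by rewrite subrr /sqnorm big1 // => i _; rewrite mxE expr0n.
apply: lerD.
  rewrite /wt /node /= !dist0 [sqnorm (P (l, hi l) - _)]sqnormB arc_dist // /W.
  by rewrite le_eqVlt; apply/orP; left; apply/eqP; field.
apply: ler_sum => l' ll'.
have c b b' : 1 <= sqnorm (P (node (l, b)) - P (node (l', b'))) by rewrite cross_ge //= eq_sym.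
have m0 : 0 <= mu l / 2 * (mu l' / 2) by rewrite mulr_ge0 // divr_ge0.
rewrite /wt /=.
have -> : mu l * mu l' = 4 * (mu l / 2 * (mu l' / 2)) by field.
have := c true true; have := c true false; have := c false true; have := c false false.
move: m0; rewrite /wt; set m := mu l / 2 * _; nra.
Qed.

(** The weighted mean of the squared distances from the center to the nodes is at most [q], and by
    [variance_identity] at least their variance. *)
Lemma enclosed_weights_ge s q : enclosed s q ->
  (forall l, mu l != 0 -> (l, lo l) \in s /\ (l, hi l) \in s) ->
  2^-1 * (1 - \sum_l mu l ^+ 2) + 4^-1 * \sum_l mu l ^+ 2 * W l <= q.
Proof.
move=> [x xs] ends; apply: le_trans nodes_variance_ge _.
have := variance_identity node_weights_sum (fun e => P (node e)) x.
move=> E; have: \sum_e wt e * sqnorm (x - P (node e)) <= q.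
  rewrite -[q]mul1r -node_weights_sum mulr_suml; apply: ler_sum => -[l b] _; rewrite /wt /=.
  have [->|/ends[slo shi]] := eqVneq (mu l) 0; first by rewrite !mul0r.
  by rewrite ler_wpM2l ?divr_ge0 // xs // /node; case: b.
by rewrite E; apply: le_trans; rewrite lerDr sqnorm_ge0.
Qed.

(** The center is the weighted mean of the nodes. Its squared distance to a point is the mean
    squared distance from that point to the nodes, minus their variance. *)
Lemma weights_enclosed s q :
  (forall l i, (l, i) \in s -> (lo l <= i <= hi l)%N /\
     1 - mu l + eps + mu l * W l / 2 -
     (2^-1 * (1 - \sum_l mu l ^+ 2) + 4^-1 * \sum_l mu l ^+ 2 * W l) <= q) ->
  enclosed s q.
Proof.
move=> H; exists (\sum_e wt e *: P (node e)) => -[l i] ls.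
have [/andP[lo_i i_hi] qle] := H l i ls; apply: le_trans qle.
rewrite sqnormB; have := variance_identity node_weights_sum (fun e => P (node e)) (P (l, i)).
move/eqP; rewrite -subr_eq => /eqP <-; apply: lerB nodes_variance_ge.
rewrite sum_nodes (bigD1 l) //= /wt /node /=.
(* By superadditivity of [om], the squared distances from a point of the part to its two ends add up
   to at most [W l]. *)
have A : mu l / 2 * sqnorm (P (l, i) - P (l, hi l)) + mu l / 2 * sqnorm (P (l, i) - P (l, lo l)) <=
   mu l * W l / 2.
  have -> : mu l * W l / 2 = mu l / 2 * W l by field.
  rewrite arc_dist // sqnormB arc_dist // -mulrDr ler_wpM2l ?divr_ge0 //.
  have := @om_superadd (hi l - i) (i - lo l); rewrite addnBA // subnK //; apply.
  by apply: leq_trans (leq_subr _ _) _; rewrite -ltnS.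
have B : \sum_(l' | l' != l) (mu l' / 2 * sqnorm (P (l, i) - P (l', hi l')) +
   mu l' / 2 * sqnorm (P (l, i) - P (l', lo l'))) <= 1 - mu l + eps.
  apply: (@le_trans _ _ (\sum_(l' | l' != l) mu l' * (1 + eps))).
    apply: ler_sum => l' ll'.
    have : sqnorm (P (l, i) - P (l', hi l')) <= 1 + eps by rewrite cross_le //= eq_sym.
    have : sqnorm (P (l, i) - P (l', lo l')) <= 1 + eps by rewrite cross_le //= eq_sym.
    by have := mu_ge0 l'; nra.
  rewrite -mulr_suml; move: mu1; rewrite (bigD1 l) //= => E.
  rewrite (_ : \sum_(i < g | i != l) mu i = 1 - mu l); last by move: E; lra.
  by have := mulr_ge0 (mu_ge0 l) eps_ge0; lra.
by have := lerD A B; lra.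
Qed.

End Weights.

Lemma om0 : om 0 = 0.
Proof.
have := arc_dist ord0 (leqnn (@ord0 n)); rewrite subnn => <-.
by rewrite subrr; apply: big1 => i _; rewrite mxE expr0n.
Qed.

Lemma spread_ends_fun s : exists lohi : 'I_g -> 'I_n.+1 * 'I_n.+1, forall l,
  [/\ ((lohi l).1 <= (lohi l).2)%N,
      l \in groups s -> (l, (lohi l).1) \in s /\ (l, (lohi l).2) \in s,
      spread s l = ((lohi l).2 - (lohi l).1)%N
    & forall i, (l, i) \in s -> ((lohi l).1 <= i <= (lohi l).2)%N].
Proof.
suff H l : exists lh : 'I_n.+1 * 'I_n.+1,
  [/\ (lh.1 <= lh.2)%N, l \in groups s -> (l, lh.1) \in s /\ (l, lh.2) \in s,
      spread s l = (lh.2 - lh.1)%N & forall i, (l, i) \in s -> (lh.1 <= i <= lh.2)%N].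
  by have [f fP] := fin_all_exists H; exists f.
have [lg|lg] := boolP (l \in groups s); last first.
  exists (ord0, ord0); split=> //=; first exact: spread_notin.
  by move=> i /mem_groups; rewrite (negPf lg).
have [lo [hi [slo shi E H]]] := spread_ends lg.
by exists (lo, hi); split=> //=; have /andP[] := H _ slo.
Qed.

(** Take equal weights on the parts met and 0 elsewhere. *)
Lemma enclosed_ge s q : (0 < #|groups s|)%N -> enclosed s q ->
  2^-1 * (1 - #|groups s|%:R^-1) +
  (4 * #|groups s|%:R ^+ 2)^-1 * \sum_l om (spread s l) <= q.
Proof.
set G : R := #|groups s|%:R => G_gt0 sq; have [lohi H] := spread_ends_fun s.
have G0 : G != 0 by rewrite pnatr_eq0 -lt0n.
pose mu l : R := if l \in groups s then G^-1 else 0.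
have sumG (c : R) : \sum_l (if l \in groups s then c else 0) = G * c.
  by rewrite -big_mkcond sumr_const -mulr_natl.
have mu1 : \sum_l mu l = 1 by rewrite sumG divff.
have mu2 : \sum_l mu l ^+ 2 = G^-1.
  rewrite (eq_bigr (fun l => if l \in groups s then G^-1 ^+ 2 else 0)).
    by rewrite sumG expr2 mulrA divff ?mul1r.
  by move=> l _; rewrite /mu; case: ifP; rewrite // expr0n.
apply: le_trans (@enclosed_weights_ge (fun l => (lohi l).1) (fun l => (lohi l).2) mu
  _ _ mu1 s q sq _).
- rewrite mu2 lerD2l invfM -mulrA ler_pM2l ?invr_gt0 // mulr_sumr.
  apply: ler_sum => l _; have [_ _ <- _] := H l; rewrite /mu.
  case: ifP => [_|lg]; first by rewrite exprVn.
  by rewrite (spread_notin (negbT lg)) om0 !mulr0.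
- by move=> l; have [] := H l.
- by move=> l; rewrite /mu; case: ifP; rewrite ?invr_ge0 ?ler0n.
- by move=> l; rewrite /mu; have [_ Hl _ _] := H l; case: ifP => [/Hl //|_]; rewrite eqxx.
Qed.

(* The center is a weighted mean of the end points of the parts; giving the l-th part
   a weight proportional to [1 / (1 - W l / 2)] makes its bounds on the distances to
   all the parts equal. *)
Lemma enclosed_le s : (0 < #|groups s|)%N -> (forall l, om (spread s l) <= 1) ->
  enclosed s (2^-1 * (1 - #|groups s|%:R^-1) +
    (4 * #|groups s|%:R ^+ 2)^-1 * \sum_l (om (spread s l) + om (spread s l) ^+ 2) + eps).
Proof.
set G : R := #|groups s|%:R => G_gt0 W1; have [lohi H] := spread_ends_fun s.
have G0 : 0 < G by rewrite ltr0n.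
pose W l := om (spread s l).
have W0 l : 0 <= W l by apply: om_ge0.
pose z l : R := if l \in groups s then (1 - W l / 2)^-1 else 0.
pose Z := \sum_l z l.
have den l : 0 < 1 - W l / 2 by have := W1 l; rewrite -/(W l); lra.
have z_ge l : (l \in groups s)%:R <= z l.
  rewrite /z; case: ifP => //= _; rewrite invf_ge1 //; have := W0 l; lra.
have z_le l : z l <= (l \in groups s)%:R + (W l + W l ^+ 2) / 2.
  have w0 := W0 l; have w1 : W l <= 1 := W1 l.
  rewrite /z; case: ifP => _ /=; last by have := sqr_ge0 (W l); lra.
  rewrite -[_^-1]mul1r ler_pdivrMr //.
  (* The product of [1 - W / 2] and [1 + (W + W ^ 2) / 2] is [1 + W ^ 2 (1 - W) / 4], which is at
     least 1. *)
  have : 0 <= W l ^+ 2 * (1 - W l) by rewrite mulr_ge0 ?sqr_ge0 //; lra.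
  by lra.
have sumg : \sum_l (l \in groups s)%:R = G.
  rewrite /G -sum1_card natr_sum [RHS]big_mkcond.
  by apply: eq_bigr => l _; case: (l \in _).
have Z_ge : G <= Z by rewrite -sumg; apply: ler_sum.
pose S := \sum_l (W l + W l ^+ 2).
have Z_le : Z <= G + S / 2.
  by rewrite -sumg mulr_suml -big_split; apply: ler_sum.
have Z0 : 0 < Z by apply: lt_le_trans Z_ge.
pose mu l := Z^-1 * z l.
have z0 l : 0 <= z l by apply: le_trans (z_ge l).
have mu1 : \sum_l mu l = 1 by rewrite -mulr_sumr mulVf ?gt_eqF.
(* On each part met, [mu l - mu l * W l / 2] equals [Z^-1], so the bound in [weights_enclosed]
   becomes [2^-1 * (1 - Z^-1) + eps]. *)
have muW l : mu l ^+ 2 * (1 - W l / 2) = Z^-1 * mu l.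
  rewrite /mu /z; case: ifP => _; last by rewrite !mulr0 expr0n mul0r.
  by field; rewrite !gt_eqF // /den; have := den l; lra.
have var : \sum_l mu l ^+ 2 * (1 - W l / 2) = Z^-1.
  by rewrite (eq_bigr _ (fun l _ => muW l)) -mulr_sumr mu1 mulr1.
have {}var : \sum_l mu l ^+ 2 - (\sum_l mu l ^+ 2 * W l) / 2 = Z^-1.
  rewrite -var mulr_suml -sumrB; apply: eq_bigr => l _; lra.
have fin : 2^-1 * (1 - Z^-1) <= 2^-1 * (1 - G^-1) + (4 * G ^+ 2)^-1 * S.
  have -> : 2^-1 * (1 - G^-1) + (4 * G ^+ 2)^-1 * S = 2^-1 * (1 - (G - S / 2) / G ^+ 2).
    by field; rewrite gt_eqF.
  rewrite ler_pM2l ?invr_gt0 // lerD2l lerN2 ler_pdivrMr ?exprn_gt0 //.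
  rewrite [Z^-1 * _]mulrC ler_pdivlMr //.
  (* In the nontrivial case use [Z <= G + S / 2] and the difference of two squares. *)
  have [neg|pos] := lerP (G - S / 2) 0.
    by apply: (@le_trans _ _ 0); [rewrite mulr_le0_ge0 // ltW | rewrite sqr_ge0].
  apply: (@le_trans _ _ ((G - S / 2) * (G + S / 2))); first by rewrite ler_pM2l.
  by have := sqr_ge0 S; lra.
apply: (@weights_enclosed (fun l => (lohi l).1) (fun l => (lohi l).2) mu _ _ mu1).
- by move=> l; have [] := H l.
- by move=> l; apply: mulr_ge0 (z0 l); rewrite invr_ge0 ltW.
move=> l i ls; have [_ _ E Hl] := H l; split; first exact: Hl.
have lg : l \in groups s by apply: mem_groups ls.
have -> : \sum_l mu l ^+ 2 * om ((lohi l).2 - (lohi l).1) = \sum_l mu l ^+ 2 * W l.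
  by apply: eq_bigr => l' _; rewrite /W; have [_ _ -> _] := H l'.
rewrite -E -/(W l).
have muWl : mu l - mu l * W l / 2 = Z^-1.
  rewrite /mu /z lg; field; have := den l => d0.
  by apply/andP; split; rewrite gt_eqF //; lra.
by rewrite -/S; move: fin var muWl; lra.
Qed.

Lemma enclosedW s q q' : q <= q' -> enclosed s q -> enclosed s q'.
Proof. by move=> qq [x xs]; exists x => v /xs H; apply: le_trans qq. Qed.

Hypothesis h_gt0 : 0 < h.
Hypothesis k_gt0 : (0 < k)%N.
Hypothesis om_lower : forall m, (m <= n)%N -> h * m%:R ^+ 2 * (1 - (4 * g%:R)^-1) <= om m.
Hypothesis om_upper : forall m, (m <= n)%N -> om m + om m ^+ 2 <= h * m%:R ^+ 2 * (1 + (4 * k%:R)^-1).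
Hypothesis om_small : om n + om n ^+ 2 <= (g%:R ^+ 2)^-1.
Hypothesis eps_small : eps <= (4 * g%:R ^+ 2)^-1.
Hypothesis eps_h : 16 * g%:R ^+ 2 * eps <= h.
Hypothesis h_small : h * g%:R < 1.

(** A squared radius halfway between the values for costs [j] and [j + 1]. The relative errors in
    [om_lower] and [om_upper] shift the costs [j + 1 <= g] and [j <= k] by at most a quarter, and
    [eps_h] fits [eps] into the remaining quarter. *)
Definition threshold (G j : nat) : R :=
  2^-1 * (1 - G%:R^-1) + (4 * G%:R ^+ 2)^-1 * (h * (j%:R + 2^-1)).

(** One more part raises the leading term by [1 / (2 G (G + 1))], at least [1 / (4 G ^ 2)], while
    [h * (j + 2^-1) <= h * g < 1]. *)
Lemma threshold_gap G j : (0 < G)%N -> (j <= k)%N ->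
  (4 * G%:R ^+ 2)^-1 * (h * (j%:R + 2^-1)) < 2^-1 * (G%:R^-1 - (G%:R + 1)^-1).
Proof.
move=> G0 jk; have GR0 : 0 < G%:R :> R by rewrite ltr0n.
have jkR : j%:R <= k%:R :> R by rewrite ler_nat.
have hj : h * (j%:R + 2^-1) < 1.
  by apply: le_lt_trans h_small; rewrite ler_pM2l // -[g%:R]natr1; lra.
have G1 : 1 <= G%:R :> R by rewrite ler1n.
have B : (2 * G%:R ^+ 2)^-1 <= G%:R^-1 - (G%:R + 1)^-1 :> R.
  have -> : G%:R^-1 - (G%:R + 1)^-1 = (G%:R * (G%:R + 1))^-1 :> R.
    by field; rewrite !gt_eqF //; lra.
  rewrite lef_pV2 ?posrE ?mulr_gt0 ?exprn_gt0 //; last lra.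
  by rewrite expr2 mulrCA ler_pM2l //; lra.
apply: lt_le_trans (_ : 2^-1 * (2 * G%:R ^+ 2)^-1 <= _); last by rewrite ler_pM2l ?invr_gt0.
have -> : 2^-1 * (2 * G%:R ^+ 2)^-1 = (4 * G%:R ^+ 2)^-1 * 1 :> R by field; rewrite gt_eqF.
by rewrite ltr_pM2l // invr_gt0 mulr_gt0 // exprn_gt0.
Qed.

Lemma threshold_gt0 G j : (0 < G)%N -> 0 < threshold G j.
Proof.
move=> G0; apply: ltr_wpDl.
  by rewrite mulr_ge0 ?invr_ge0 // subr_ge0 invf_le1 ?ltr0n // ler1n.
rewrite mulr_gt0 ?invr_gt0 ?mulr_gt0 ?exprn_gt0 ?ltr0n //.
by have : 0 <= j%:R :> R by []; lra.
Qed.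

Lemma threshold_ltS p : (p < 2 * k)%N ->
  threshold (minn p k).+1 (p - k) < threshold (minn p.+1 k).+1 (p.+1 - k).
Proof.
move=> p2k; have [pk|] := boolP (p < k)%N; last rewrite -leqNgt => kp.
  rewrite (minn_idPl (ltnW pk)) (minn_idPl pk).
  have -> : (p - k = 0)%N by apply/eqP; rewrite subn_eq0 ltnW.
  have -> : (p.+1 - k = 0)%N by apply/eqP; rewrite subn_eq0.
  have := threshold_gap (ltn0Sn p) (leq0n k).
  have : 0 <= (4 * p.+2%:R ^+ 2)^-1 * (h * (0%:R + 2^-1)).
    by rewrite mulr_ge0 ?invr_ge0 ?mulr_ge0 ?sqr_ge0 ?(ltW h_gt0) //; lra.
  rewrite /threshold [p.+1%:R + 1]natr1; set a := p.+1%:R^-1; set b := p.+2%:R^-1.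
  by set x := _ * (h * _); set y := _ * (h * _); lra.
rewrite (minn_idPr kp) (minn_idPr (leqW kp)) /threshold ltrD2l ltr_pM2l; last first.
  by rewrite invr_gt0 mulr_gt0 // exprn_gt0 // ltr0n.
by rewrite ltr_pM2l // ltrD2r ltr_nat subSn.
Qed.

Lemma om_mono a b : (a <= b <= n)%N -> om a <= om b.
Proof.
move=> /andP[ab bn]; have := @om_superadd a (b - a); rewrite subnKC // => /(_ bn).
by apply: le_trans; rewrite lerDl.
Qed.

Lemma spread_ltn s l : (spread s l <= n)%N.
Proof.
by apply: spread_le => i1 i2 _ _; apply: leq_trans (leq_subr _ _) _; rewrite -ltnS.
Qed.

Lemma om_le1 m : (m <= n)%N -> om m <= 1.
Proof.
move=> mn; have : om m <= om n by rewrite om_mono // mn leqnn.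
have : (g%:R ^+ 2)^-1 <= 1 :> R.
  by rewrite invf_le1 ?exprn_gt0 ?ltr0n // exprn_ege1 // ler1n.
by have := om_small; have := sqr_ge0 (om n); set c := (_ ^+ 2)^-1; lra.
Qed.

Lemma sum_spread_cost s : \sum_l (spread s l)%:R ^+ 2 = (cost s)%:R :> R.
Proof. by rewrite /cost natr_sum; apply: eq_bigr => l _; rewrite natrX. Qed.

Lemma enclosed_threshold s G j : (0 < #|groups s|)%N -> (0 < G <= g)%N -> (j <= k)%N ->
  enclosed s (threshold G j) <->
  (#|groups s| < G)%N || (#|groups s| == G) && (cost s <= j)%N.
Proof.
move=> c0 /andP[G0 Gg] jk.
have j_ge0 : 0 <= j%:R :> R by [].
have jkR : j%:R <= k%:R :> R by rewrite ler_nat.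
have gk : g%:R = k%:R + 1 :> R by rewrite -natr1.
have k0 : 0 < k%:R :> R by rewrite ltr0n.
have GR0 : 0 < G%:R :> R by rewrite ltr0n.
have hj0 : 0 <= h * (j%:R + 2^-1) by rewrite mulr_ge0 ?(ltW h_gt0) //; lra.
have sp0 : 0 <= (4 * G%:R ^+ 2)^-1 * (h * (j%:R + 2^-1)) by rewrite mulr_ge0 // invr_ge0 mulr_ge0 ?sqr_ge0.
have [ltG|gtG|eqG] /= := ltngtP #|groups s| G.
(* Fewer parts: widths and [eps] each contribute at most [1 / (4 g ^ 2)], and [1 / g ^ 2] is at most
   [1 / c - 1 / G]. *)
- split=> // _; apply: enclosedW (enclosed_le c0 (fun l => om_le1 (spread_ltn s l))).
  set c := #|groups s| in c0 ltG *.
  have cR0 : 0 < c%:R :> R by rewrite ltr0n.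
  have cG : c%:R + 1 <= G%:R :> R by rewrite natr1 ler_nat.
  have Gg' : G%:R <= g%:R :> R by rewrite ler_nat.
  have sumW : \sum_l (om (spread s l) + om (spread s l) ^+ 2) <= c%:R * (g%:R ^+ 2)^-1.
    rewrite mulr_natl -sumr_const [X in _ <= X]big_mkcond; apply: ler_sum => l _ /=.
    case: ifP => [_|lg]; last by rewrite (spread_notin (negbT lg)) om0 expr0n addr0.
    apply: le_trans om_small; have m : om (spread s l) <= om n by rewrite om_mono // spread_ltn leqnn.
    by apply: lerD => //; rewrite ler_sqr ?nnegrE.
  have c1 : 1 <= c%:R :> R by rewrite ler1n.
  have cg : c%:R + 1 <= g%:R :> R by apply: le_trans Gg'.
  have A : (g%:R ^+ 2)^-1 <= c%:R^-1 - G%:R^-1 :> R.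
    have -> : c%:R^-1 - G%:R^-1 = (G%:R - c%:R) / (c%:R * G%:R) :> R by field; rewrite !gt_eqF.
    rewrite ler_pdivlMr ?mulr_gt0 // ler_pdivrMl ?exprn_gt0 ?ltr0n //.
    apply: (@le_trans _ _ (g%:R ^+ 2)); last by rewrite ler_peMr ?sqr_ge0 //; lra.
    by rewrite expr2 ler_pM //; lra.
  have B : (4 * c%:R ^+ 2)^-1 * (c%:R * (g%:R ^+ 2)^-1) <= 4^-1 * (g%:R ^+ 2)^-1 :> R.
    rewrite mulrA ler_wpM2r ?invr_ge0 ?sqr_ge0 // (_ : _ * c%:R = (4 * c%:R)^-1); last first.
      by field; rewrite gt_eqF.
    by rewrite lef_pV2 ?posrE ?mulr_gt0 // ler_peMr.
  have C : (4 * c%:R ^+ 2)^-1 * \sum_l (om (spread s l) + om (spread s l) ^+ 2) <=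
      (4 * c%:R ^+ 2)^-1 * (c%:R * (g%:R ^+ 2)^-1).
    by rewrite ler_wpM2l // invr_ge0 mulr_ge0 ?sqr_ge0.
  move: eps_small; rewrite /threshold invfM => E.
  move: A B C E sp0; set g2 := (g%:R ^+ 2)^-1; set ci := c%:R^-1; set Gi := G%:R^-1.
  by set x := _ * \sum_l _; set y := _ * (_ * g2); set z := _ * (h * _); lra.
(* More parts: by [threshold_gap] the leading term in [enclosed_ge] already exceeds the
   threshold. *)
- split=> // /(enclosed_ge c0) H; exfalso.
  set c := #|groups s| in c0 gtG H.
  have cR0 : 0 < c%:R :> R by rewrite ltr0n.
  have cG : G%:R + 1 <= c%:R :> R by rewrite natr1 ler_nat.
  have sumW : 0 <= \sum_l om (spread s l) by apply: sumr_ge0.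
  have A : c%:R^-1 <= (G%:R + 1)^-1 :> R by rewrite lef_pV2 ?posrE //; lra.
  have B := threshold_gap G0 jk.
  have D : 0 <= (4 * c%:R ^+ 2)^-1 * \sum_l om (spread s l).
    by rewrite mulr_ge0 // invr_ge0 mulr_ge0 ?sqr_ge0.
  move: A B D H; rewrite /threshold; set ci := c%:R^-1; set Gi := G%:R^-1.
  set x := _ * \sum_l _; set z := _ * (h * _); set w := (G%:R + 1)^-1.
  by lra.
(* Exactly [G] parts: the leading terms agree and only the costs are compared. *)
rewrite /threshold -eqG; set c := #|groups s| in c0 eqG *.
have a0 : 0 < (4 * c%:R ^+ 2)^-1 :> R by rewrite invr_gt0 mulr_gt0 // exprn_gt0 // ltr0n.
have cc : c%:R <= k%:R + 1 :> R by rewrite natr1 eqG ler_nat.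
split=> [/(enclosed_ge c0)|cj].
  rewrite lerD2l ler_pM2l // => H; rewrite leqNgt; apply/negP => jc.
  have : h * (cost s)%:R * (1 - (4 * g%:R)^-1) <= \sum_l om (spread s l).
    rewrite -sum_spread_cost mulr_sumr mulr_suml.
    by apply: ler_sum => l _; apply/om_lower/spread_ltn.
  move=> H2; have := le_trans H2 H; apply/negP; rewrite -ltNge -mulrA ltr_pM2l //.
  have jcR : j%:R + 1 <= (cost s)%:R :> R by rewrite natr1 ler_nat.
  have q0 : 0 < (4 * g%:R)^-1 :> R by rewrite invr_gt0 mulr_gt0 // ltr0n.
  have q1 : (k%:R + 1) * (4 * g%:R)^-1 = 4^-1 :> R.
    by rewrite gk; field; rewrite gt_eqF //; lra.
  have q2 : (4 * g%:R)^-1 <= 1 :> R by rewrite invf_le1 ?mulr_gt0 ?ltr0n // gk; lra.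
  move: q0 q1 q2; set q := (4 * g%:R)^-1 => q0 q1 q2.
  apply: (@lt_le_trans _ _ ((j%:R + 1) * (1 - q))).
    have : (j%:R + 1) * q <= 4^-1 :> R by rewrite -q1 ler_wpM2r ?(ltW q0) //; lra.
    by lra.
  by rewrite ler_wpM2r // subr_ge0.
apply: enclosedW (enclosed_le c0 (fun l => om_le1 (spread_ltn s l))).
have : \sum_l (om (spread s l) + om (spread s l) ^+ 2) <= h * (j%:R + 4^-1).
  apply: (@le_trans _ _ (h * (cost s)%:R * (1 + (4 * k%:R)^-1))).
    rewrite -sum_spread_cost mulr_sumr mulr_suml.
    by apply: ler_sum => l _; apply/om_upper/spread_ltn.
  rewrite -mulrA ler_pM2l //.
  have cjR : (cost s)%:R <= j%:R :> R by rewrite ler_nat.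
  have q0 : 0 < (4 * k%:R)^-1 :> R by rewrite invr_gt0 mulr_gt0.
  have q1 : k%:R * (4 * k%:R)^-1 = 4^-1 :> R by field; rewrite gt_eqF.
  move: q0 q1; set q := (4 * k%:R)^-1 => q0 q1.
  have : j%:R * q <= 4^-1 :> R by rewrite -q1 ler_wpM2r ?(ltW q0).
  have : (cost s)%:R * (1 + q) <= j%:R * (1 + q).
    by rewrite ler_wpM2r //; lra.
  by lra.
move=> sumW; rewrite -addrA lerD2l.
have -> : eps = (4 * c%:R ^+ 2)^-1 * (4 * c%:R ^+ 2 * eps) by rewrite mulrA mulVf ?mul1r // -invr_eq0 gt_eqF.
rewrite -mulrDr ler_pM2l //.
have c2 : c%:R ^+ 2 <= g%:R ^+ 2 :> R by rewrite gk ler_sqr ?nnegrE //; lra.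
have : c%:R ^+ 2 * eps <= g%:R ^+ 2 * eps by rewrite ler_wpM2r.
by move: eps_h sumW; lra.
Qed.

End EnclosingBall.

(** * The points on the arcs *)

Section SmallAngles.
Import numFieldNormedType.Exports.
Variable R : realType.
Implicit Types x y : R.

Lemma sin_mean_value x : 0 < x -> exists2 c, 0 < c < x & sin x = cos c * x.
Proof.
move=> x0; have [|c] := @MVT R sin cos 0 x x0 (fun y _ => is_derive_sin y).
  exact/continuous_subspaceT/continuous_sin.
by rewrite in_itv /= sin0 !subr0 => cx ->; exists c.
Qed.

Lemma sin_le x : 0 <= x -> sin x <= x.
Proof.
rewrite le_eqVlt => /predU1P[<-|x0]; first by rewrite sin0.
by have [c _ ->] := sin_mean_value x0; rewrite ler_piMl ?cos_le1 // ltW.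
Qed.

Lemma sqr_sin_le x : sin x ^+ 2 <= x ^+ 2.
Proof.
wlog x0 : x / 0 <= x => [H|].
  by have [/H//|/ltW x0] := lerP 0 x; rewrite -sqrrN -sinN -[x in _ <= x]sqrrN H // oppr_ge0.
rewrite -[sin x ^+ 2]real_normK ?num_real // ler_sqr ?nnegrE // ler_norml sin_le // andbT.
have [x1|x1] := lerP 1 x; first by rewrite (le_trans _ (sin_geN1 x)) // lerN2.
apply: le_trans (_ : 0 <= _); first by rewrite oppr_le0.
apply: sin_ge0_pi; rewrite x0 /=; apply: le_trans (ltW x1) _.
by apply: le_trans (@pi_ge2 R); rewrite ler1n.
Qed.

Lemma one_sub_cos x : 1 - cos x = 2 * sin (x / 2) ^+ 2.
Proof.
have -> : cos x = cos (x / 2 *+ 2) by rewrite -mulr_natr divfK ?pnatr_eq0.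
by rewrite cos_mulr2n sin2cos2 -mulr_natr; ring.
Qed.

Lemma one_sub_cos_ge0 x : 0 <= 1 - cos x.
Proof. by rewrite subr_ge0 cos_le1. Qed.

Lemma one_sub_cos_le x : 1 - cos x <= x ^+ 2 / 2.
Proof.
rewrite one_sub_cos; have := sqr_sin_le (x / 2).
have -> : x ^+ 2 / 2 = 2 * (x / 2) ^+ 2 by field.
by move=> H; rewrite ler_pM2l.
Qed.

(** By the mean value theorem [sin x = cos c * x] with [0 < c < x], and the square of [cos c] is at
    least that of [1 - c ^ 2 / 2], hence at least [1 - c ^ 2]. *)
Lemma sqr_sin_ge x : 0 <= x <= 1 -> x ^+ 2 * (1 - x ^+ 2) <= sin x ^+ 2.
Proof.
case/andP; rewrite le_eqVlt => /predU1P[<-|x0] x1; first by rewrite sin0 expr0n mul0r.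
have [c /andP[c0 cx] ->] := sin_mean_value x0.
rewrite exprMn mulrC ler_pM2r ?exprn_gt0 //.
have := one_sub_cos_le c; have : c ^+ 2 <= x ^+ 2 by rewrite ler_sqr ?nnegrE ltW.
have := cos_le1 c; have := sqr_ge0 c; set y := c ^+ 2; set z := x ^+ 2; set C := cos c.
have : x ^+ 2 <= 1 by rewrite expr_le1 // ltW.
rewrite -/z => *; have : 0 <= C by lra.
have : (1 - y / 2) ^+ 2 <= C ^+ 2 by rewrite ler_sqr ?nnegrE; lra.
by have := sqr_ge0 y; lra.
Qed.

(** The difference is [2 sin x sin y cos (x + y)]. Superadditivity of squared chords along an arc
    follows. *)
Lemma sqr_sin_superadd x y : 0 <= x -> 0 <= y -> x + y <= pi / 2 ->
  sin x ^+ 2 + sin y ^+ 2 <= sin (x + y) ^+ 2.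
Proof.
move=> x0 y0 xy; have p0 := pi_ge0 R.
have -> : sin (x + y) ^+ 2 = sin x ^+ 2 + sin y ^+ 2 + 2 * (sin x * sin y * cos (x + y)).
  by rewrite sinD cosD; ring: (cos2sin2 x) (cos2sin2 y).
rewrite lerDl mulr_ge0 // mulr_ge0 ?mulr_ge0 ?sin_ge0_pi ?cos_ge0_pihalf //; lra.
Qed.

End SmallAngles.

(** * Distances between points of the circles *)

Section SimplexDistances.
Variables (R : realType) (k : nat) (u : 'I_k.+1 -> 'rV[R]_(k + k.+1)).
Hypotheses (k_gt0 : (0 < k)%N) (u_simplex : unit_regular_simplex u).
Local Notation K := (k%:R : R).

Let K_gt0 : 0 < K. Proof. by rewrite ltr0n. Qed.
Let Kn0 : K != 0. Proof. by rewrite gt_eqF. Qed.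
Let K1n0 : K + 1 != 0. Proof. by rewrite natr1 pnatr_eq0. Qed.

Lemma height_sqr : height R k ^+ 2 = (K + 1) / (2 * K).
Proof. by rewrite sqr_sqrtr ?divr_ge0 ?ler0n // natrM -[k.+1%:R]natr1. Qed.

Lemma height_gt0 : 0 < height R k.
Proof. by rewrite sqrtr_gt0 divr_gt0 ?ltr0n // muln_gt0. Qed.

Let dot (x y : 'rV[R]_(k + k.+1)) : R := \sum_i x 0 i * y 0 i.

Let sqnorm_sub x y : sqnorm (x - y) = dot x x + dot y y - 2 * dot x y.
Proof.
rewrite /sqnorm /dot mulr_sumr -big_split -sumrB; apply: eq_bigr => i _ /=.
by rewrite !mxE; ring.
Qed.

Let u_sum : \sum_l u l = 0.
Proof.
have [_ _ /eqP] := u_simplex; rewrite scaler_eq0 invr_eq0 pnatr_eq0 /=.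
by move/eqP.
Qed.

Let dot_sum l : \sum_j dot (u l) (u j) = 0.
Proof.
rewrite exchange_big big1 //= => i _; rewrite -mulr_sumr.
by rewrite -summxE u_sum mxE mulr0.
Qed.

Let unit_edges l j : l != j -> dot (u l) (u l) + dot (u j) (u j) - 2 * dot (u l) (u j) = 1.
Proof.
have [_ E _] := u_simplex; move=> /E E1; rewrite -sqnorm_sub.
have s0 : 0 <= sqnorm (u l - u j) := sqnorm_ge0 _.
by rewrite -(sqr_sqrtr s0) -/(enorm (u l - u j)) E1 expr1n.
Qed.

(** Summing the edge equations at one vertex removes the mixed products, because the vertices sum to
    zero. Summing again over the vertices gives the total of the squared norms, and then each of
    them. *)
Lemma simplex_gram_diag l : dot (u l) (u l) = K / (2 * (K + 1)).
Proof.
have E m : (K + 1) * dot (u m) (u m) + \sum_j dot (u j) (u j) = K.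
  transitivity (\sum_j (dot (u m) (u m) + dot (u j) (u j) - 2 * dot (u m) (u j))).
    rewrite sumrB big_split /= -mulr_sumr dot_sum mulr0 subr0.
    by rewrite sumr_const card_ord -[_ *+ k.+1]mulr_natl -[k.+1%:R]natr1.
  rewrite (bigD1 m) //= -[RHS]add0r; congr (_ + _); first by ring.
  transitivity (\sum_(j < k.+1 | j != m) (1 : R)).
    by apply: eq_bigr => j jm; apply: unit_edges; rewrite eq_sym.
  by rewrite sumr_const cardC1 card_ord.
have S : \sum_j dot (u j) (u j) = K / 2.
  have : \sum_(m < k.+1) ((K + 1) * dot (u m) (u m) + \sum_j dot (u j) (u j)) = (K + 1) * K.
    by rewrite (eq_bigr _ (fun m _ => E m)) sumr_const card_ord -[_ *+ k.+1]mulr_natl -[k.+1%:R]natr1.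
  rewrite big_split /= -mulr_sumr sumr_const card_ord -[_ *+ k.+1]mulr_natl -[k.+1%:R]natr1.
  set S := \sum_j _ => H; have {H} : (K + 1) * (S * 2) = (K + 1) * K by rewrite -H; ring.
  by move=> H; have {H} <- := mulfI K1n0 H; field.
have := E l; rewrite S => H; apply: (mulfI K1n0).
have -> : (K + 1) * (K / (2 * (K + 1))) = K - K / 2 by field; rewrite K1n0.
by move: H; lra.
Qed.

Lemma simplex_gram_offdiag l j : l != j -> dot (u l) (u j) = - (2 * (K + 1))^-1.
Proof.
move=> /unit_edges; rewrite !simplex_gram_diag => H.
have -> : dot (u l) (u j) =
  (K / (2 * (K + 1)) + K / (2 * (K + 1)) -
   (K / (2 * (K + 1)) + K / (2 * (K + 1)) - 2 * dot (u l) (u j))) / 2 by field; rewrite K1n0.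
by rewrite H; field; rewrite K1n0.
Qed.

Lemma facet_barycenterE l : facet_barycenter u l = - K^-1 *: u l.
Proof.
rewrite /facet_barycenter; have := u_sum; rewrite (bigD1 l) //= => /eqP.
by rewrite addr_eq0 => /eqP ->; rewrite scalerN scaleNr opprK.
Qed.

Let e l : 'rV[R]_(k + k.+1) := delta_mx 0 (rshift k l).

Let amp t : R := ((K + 1) * cos t - 1) / K.

Lemma circle_pointE l t :
  circle_point u l t = amp t *: u l + (height R k * sin t) *: e l.
Proof.
rewrite /circle_point facet_barycenterE; congr (_ + _).
rewrite scaleNr opprK -{2}[u l]scale1r -scalerDl scalerA -scaleNr -scalerDl.
by congr (_ *: _); rewrite /amp; field.
Qed.

Let dotDZ (a b c f : R) (x y z w : 'rV[R]_(k + k.+1)) :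
  dot (a *: x + b *: y) (c *: z + f *: w) =
  a * c * dot x z + a * f * dot x w + b * c * dot y z + b * f * dot y w.
Proof.
rewrite /dot !mulr_sumr -!big_split; apply: eq_bigr => i _ /=.
by rewrite !mxE; ring.
Qed.

Let dot_e l j : dot (e l) (e j) = (l == j)%:R.
Proof.
rewrite /dot (bigD1 (rshift k l)) //= big1 => [|i il]; last first.
  by rewrite !mxE (negPf il) andbF mul0r.
by rewrite !mxE !eqxx addr0 mul1r (inj_eq (@rshift_inj _ _)).
Qed.

Let dot_ue l j : dot (u l) (e j) = 0.
Proof.
rewrite /dot (bigD1 (rshift k j)) //= big1 => [|i ij]; last first.
  by rewrite !mxE (negPf ij) andbF mulr0.
by have [-> _ _] := u_simplex; rewrite mul0r addr0.
Qed.

Let dotC x y : dot x y = dot y x.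
Proof. by apply: eq_bigr => i _; rewrite mulrC. Qed.

(** The vectors [e l] and [e j] are orthogonal to each other and to the simplex, so the mixed
    product involves only cosines; the squared sines in the norms are rewritten as [1 - cos ^ 2]. *)
Lemma circle_dist_cross l j t t' : l != j ->
  sqnorm (circle_point u l t - circle_point u j t') =
  1 + (K + 1) / K ^+ 2 * ((1 - cos t) * (1 - cos t')).
Proof.
move=> lj; rewrite sqnorm_sub !circle_pointE !dotDZ !dot_e !dot_ue.
rewrite ![dot (e _) (u _)]dotC !dot_ue !eqxx (negPf lj) !simplex_gram_diag simplex_gram_offdiag //.
have -> : height R k * sin t * (height R k * sin t) = height R k ^+ 2 * sin t ^+ 2 by ring.
have -> : height R k * sin t' * (height R k * sin t') = height R k ^+ 2 * sin t' ^+ 2 by ring.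
by rewrite height_sqr !sin2cos2 /amp /=; field; rewrite Kn0 K1n0.
Qed.

Lemma circle_dist_same l t t' :
  sqnorm (circle_point u l t - circle_point u l t') =
  4 * height R k ^+ 2 * sin ((t - t') / 2) ^+ 2.
Proof.
have -> : 4 * height R k ^+ 2 * sin ((t - t') / 2) ^+ 2 = 2 * height R k ^+ 2 * (1 - cos (t - t')).
  by rewrite one_sub_cos; ring.
rewrite sqnorm_sub !circle_pointE !dotDZ !dot_e !dot_ue.
rewrite ![dot (e _) (u _)]dotC !dot_ue !eqxx !simplex_gram_diag cosB.
have -> : height R k * sin t * (height R k * sin t) = height R k ^+ 2 * sin t ^+ 2 by ring.
have -> : height R k * sin t' * (height R k * sin t') = height R k ^+ 2 * sin t' ^+ 2 by ring.
have -> : height R k * sin t * (height R k * sin t') = height R k ^+ 2 * (sin t * sin t') by ring.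
by rewrite height_sqr !sin2cos2 /amp /=; field; rewrite Kn0 K1n0.
Qed.

End SimplexDistances.

(** * Metric estimates and Cech complexes of the arc points *)

Section ArcPoints.
Variables (R : realType) (k n : nat) (Delta : R) (u : 'I_k.+1 -> 'rV[R]_(k + k.+1)).
Hypotheses (k_gt0 : (0 < k)%N) (n_gt0 : (0 < n)%N) (u_simplex : unit_regular_simplex u).
Local Notation g := k.+1.
Local Notation V := ('I_g * 'I_n.+1)%type.
Local Notation H := (height R k).

Let alpha : R := asin (Delta / H).
Hypothesis alpha_gt0 : 0 < alpha.
Hypothesis alpha_small : 8 * g%:R * n%:R * alpha <= 1.

Let P (v : V) : 'rV[R]_(k + k.+1) := circle_point u v.1 (@arc_angle R k n Delta v.2).
(** Half the angular spacing. Thus [om m] is the squared chord across [m] steps, with leading term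
    [h * m ^ 2]. *)
Let beta : R := alpha / n%:R.
Let om (m : nat) : R := 4 * H ^+ 2 * sin (m%:R * beta) ^+ 2.
Let h : R := 4 * H ^+ 2 * beta ^+ 2.
Let eps : R := alpha ^+ 4.

Let n1 : 1 <= n%:R :> R. Proof. by rewrite ler1n. Qed.
Let n0 : n%:R != 0 :> R. Proof. by rewrite pnatr_eq0 -lt0n. Qed.
Let k1 : 1 <= k%:R :> R. Proof. by rewrite ler1n. Qed.
Let gk : g%:R = k%:R + 1 :> R. Proof. by rewrite natr1. Qed.

Let H2_bounds : 2^-1 <= H ^+ 2 <= 1.
Proof.
have k0 : 0 < k%:R :> R by rewrite ltr0n.
rewrite height_sqr // ler_pdivlMr ?ler_pdivrMr ?mulr_gt0 //.
by apply/andP; split; move: k1; lra.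
Qed.

Let H4_ge0 : 0 <= 4 * H ^+ 2. Proof. by rewrite mulr_ge0 // sqr_ge0. Qed.

Let ga : 8 * g%:R * alpha <= 1.
Proof.
apply: le_trans alpha_small; rewrite [X in _ <= X]mulrAC ler_peMr //.
by rewrite mulr_ge0 ?mulr_ge0 // ltW.
Qed.

Let ga2 : 64 * g%:R ^+ 2 * alpha ^+ 2 <= 1.
Proof.
have -> : 64 * g%:R ^+ 2 * alpha ^+ 2 = (8 * g%:R * alpha) ^+ 2 by ring.
by rewrite expr_le1 // mulr_ge0 ?mulr_ge0 // ltW.
Qed.

Let g2 : 4 <= g%:R ^+ 2 :> R.
Proof. by rewrite gk; have := sqr_ge0 (k%:R - 1 : R); move: k1; lra. Qed.

Let alpha2_le : alpha ^+ 2 <= 256^-1.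
Proof.
have := ga2; have := ler_wpM2r (sqr_ge0 alpha) g2; lra.
Qed.

Let alpha_le : alpha <= 16^-1.
Proof. have := ga; have : alpha * 1 <= alpha * k%:R by rewrite ler_pM2l. rewrite gk; move: k1; lra. Qed.

Let beta_gt0 : 0 < beta. Proof. by rewrite divr_gt0 // ltr0n. Qed.

Let nbeta : n%:R * beta = alpha. Proof. by rewrite /beta mulrC divfK. Qed.

Let mbeta m : (m <= n)%N -> 0 <= m%:R * beta <= alpha.
Proof.
move=> mn; rewrite mulr_ge0 ?(ltW beta_gt0) //= -nbeta.
by rewrite ler_pM2r // ler_nat.
Qed.

Let alpha_pi : alpha <= pi / 2.
Proof. by apply: le_trans alpha_le _; apply: le_trans (pihalf_ge1 R); lra. Qed.

Let angle_bound (i : 'I_n.+1) : `|@arc_angle R k n Delta i| <= alpha.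
Proof.
rewrite /arc_angle -/alpha ler_norml.
have -> : i%:R * (2 * alpha / n%:R) = 2 * (i%:R * beta) by rewrite /beta; field.
by have /andP[] := @mbeta i (leq_ord i); lra.
Qed.

Let one_sub_cos_angle (i : 'I_n.+1) : 0 <= 1 - cos (@arc_angle R k n Delta i) <= alpha ^+ 2 / 2.
Proof.
rewrite one_sub_cos_ge0 /=; apply: le_trans (one_sub_cos_le _) _.
rewrite ler_pM2r ?invr_gt0 // -[X in X <= _]real_normK ?num_real //.
by rewrite ler_sqr ?nnegrE // ltW.
Qed.

Let cross_coef : 0 <= ((k%:R + 1) / k%:R ^+ 2 : R) <= 2.
Proof.
have k0 : 0 < k%:R :> R by rewrite ltr0n.
apply/andP; split; first by rewrite divr_ge0 ?sqr_ge0 //; lra.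
rewrite ler_pdivrMr ?exprn_gt0 //.
by have := sqr_ge0 (k%:R - 1 : R); move: k1; lra.
Qed.

Let cross_dist (v w : V) : v.1 != w.1 -> 1 <= sqnorm (P v - P w) <= 1 + eps.
Proof.
move=> vw; rewrite /P circle_dist_cross // lerDl lerD2l.
have /andP[a0 a1] := one_sub_cos_angle v.2; have /andP[b0 b1] := one_sub_cos_angle w.2.
have /andP[c0 c1] := cross_coef.
rewrite (mulr_ge0 c0 (mulr_ge0 a0 b0)) /=.
apply: (@le_trans _ _ (2 * (alpha ^+ 2 / 2 * (alpha ^+ 2 / 2)))).
  by apply: ler_pM => //; [apply: mulr_ge0 | apply: ler_pM].
have -> : 2 * (alpha ^+ 2 / 2 * (alpha ^+ 2 / 2)) = eps / 2 by rewrite /eps; field.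
by have : 0 <= eps; [rewrite exprn_ge0 // ltW | lra].
Qed.

Let arc_dist l (i i' : 'I_n.+1) : (i <= i')%N -> sqnorm (P (l, i) - P (l, i')) = om (i' - i).
Proof.
move=> ii; rewrite /P circle_dist_same // /om /=; congr (_ * _).
rewrite -[LHS]sqrrN -sinN; congr (sin _ ^+ 2).
by rewrite /arc_angle -/alpha natrB // /beta; field.
Qed.

Let om_superadd a b : (a + b <= n)%N -> om a + om b <= om (a + b).
Proof.
move=> abn; rewrite /om -mulrDr ler_wpM2l // [(a + b)%:R]natrD [(_ + _) * beta]mulrDl.
have an : (a <= n)%N by apply: leq_trans abn; apply: leq_addr.
have bn : (b <= n)%N by apply: leq_trans abn; apply: leq_addl.
have /andP[a0 _] := mbeta an; have /andP[b0 _] := mbeta bn.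
have /andP[_] := mbeta abn; rewrite [(a + b)%:R]natrD mulrDl => abn'.
by apply: sqr_sin_superadd => //; apply: le_trans alpha_pi.
Qed.

Let om_ge0 a : 0 <= om a. Proof. by rewrite mulr_ge0 ?sqr_ge0. Qed.
Let eps_ge0 : 0 <= eps. Proof. by rewrite exprn_ge0 // ltW. Qed.
Let h_gt0 : 0 < h.
Proof.
have H_gt0 : 0 < H by apply: height_gt0.
by apply: mulr_gt0; [apply: mulr_gt0|]; rewrite ?exprn_gt0.
Qed.

Let om_lower m : (m <= n)%N -> h * m%:R ^+ 2 * (1 - (4 * g%:R)^-1) <= om m.
Proof.
move=> /mbeta/andP[x0 xa]; set x := m%:R * beta in x0 xa.
have -> : h * m%:R ^+ 2 = 4 * H ^+ 2 * x ^+ 2 by rewrite /h /x; ring.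
rewrite /om -/x -mulrA ler_wpM2l //.
apply: le_trans (_ : x ^+ 2 * (1 - x ^+ 2) <= _); last first.
  by apply: sqr_sin_ge; rewrite x0; move: alpha_le; lra.
rewrite ler_wpM2l ?sqr_ge0 // lerD2l lerN2.
have gg : 0 < g%:R :> R by rewrite ltr0n.
rewrite -[(_)^-1]mul1r ler_pdivlMr ?mulr_gt0 //.
have x2 : x ^+ 2 <= alpha ^+ 2 by rewrite ler_sqr ?nnegrE // ltW.
have : x ^+ 2 * (4 * g%:R) <= alpha ^+ 2 * (4 * g%:R) by rewrite ler_wpM2r // mulr_ge0.
have : alpha ^+ 2 * g%:R <= alpha ^+ 2 * g%:R ^+ 2.
  by rewrite ler_wpM2l ?sqr_ge0 // ler_eXnr // gk; move: k1; lra.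
by move: ga2; lra.
Qed.

Let om_le m : (m <= n)%N -> om m <= h * m%:R ^+ 2 <= 4 * alpha ^+ 2.
Proof.
move=> /mbeta/andP[x0 xa]; set x := m%:R * beta in x0 xa.
have -> : h * m%:R ^+ 2 = 4 * H ^+ 2 * x ^+ 2 by rewrite /h /x; ring.
rewrite /om -/x ler_wpM2l ?sqr_sin_le //=.
have /andP[_ H1] := H2_bounds.
by apply: ler_pM; rewrite ?sqr_ge0 ?ler_piMr // ler_sqr ?nnegrE // ltW.
Qed.

(** With [y = h * m ^ 2], one has [om m <= y <= 4 alpha ^ 2 <= 1 / (4 k)], so the square is at most
    [y / (4 k)]. *)
Let om_upper m : (m <= n)%N -> om m + om m ^+ 2 <= h * m%:R ^+ 2 * (1 + (4 * k%:R)^-1).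
Proof.
move=> /om_le/andP[]; set y := h * _ => oy ya; have o0 := om_ge0 m.
have o2 : om m ^+ 2 <= y ^+ 2 by rewrite ler_sqr ?nnegrE //; lra.
have y0 : 0 <= y by lra.
have yk : y <= (4 * k%:R)^-1.
  rewrite -[(_)^-1]mul1r ler_pdivlMr ?mulr_gt0 ?ltr0n //.
  have : alpha ^+ 2 * k%:R <= alpha ^+ 2 * g%:R ^+ 2.
    by rewrite ler_wpM2l ?sqr_ge0 // gk; move: k1; have := sqr_ge0 (k%:R : R); lra.
  have : y * (4 * k%:R) <= 4 * alpha ^+ 2 * (4 * k%:R) by rewrite ler_wpM2r // mulr_ge0.
  by move: ga2; lra.
have : y * y <= y * (4 * k%:R)^-1 by rewrite ler_wpM2l.
by move: o2; rewrite expr2; set q := (_ * _)^-1; lra.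
Qed.

Let inv_g2 (c : R) : c * g%:R ^+ 2 <= 1 -> c <= (g%:R ^+ 2)^-1.
Proof. by move=> ?; rewrite -[(_)^-1]mul1r ler_pdivlMr // exprn_gt0 // ltr0n. Qed.

Let om_small : om n + om n ^+ 2 <= (g%:R ^+ 2)^-1.
Proof.
apply: inv_g2; have /andP[o1 o2] := om_le (leqnn n); have o0 := om_ge0 n.
have o3 : om n <= 4 * alpha ^+ 2 by apply: le_trans o2.
have o4 : om n ^+ 2 <= om n by rewrite ler_iXnr //; move: alpha2_le; lra.
apply: (@le_trans _ _ (8 * alpha ^+ 2 * g%:R ^+ 2)).
  by rewrite ler_wpM2r ?sqr_ge0 //; lra.
by move: ga2; have : 0 <= alpha ^+ 2 * g%:R ^+ 2; [rewrite mulr_ge0 ?sqr_ge0 | lra].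
Qed.

Let eps_le : eps <= alpha ^+ 2 / 256.
Proof.
have -> : eps = alpha ^+ 2 * alpha ^+ 2 by rewrite /eps; ring.
by rewrite ler_wpM2l ?sqr_ge0.
Qed.

Let eps_small : eps <= (4 * g%:R ^+ 2)^-1.
Proof.
rewrite -[(_)^-1]mul1r ler_pdivlMr ?mulr_gt0 ?exprn_gt0 ?ltr0n //.
have : eps * (4 * g%:R ^+ 2) <= alpha ^+ 2 / 256 * (4 * g%:R ^+ 2).
  by rewrite ler_wpM2r // mulr_ge0 ?sqr_ge0.
by move: ga2; lra.
Qed.

(** Here [eps] is [alpha ^ 4] while [h] is of order [alpha ^ 2 / n ^ 2]; this is why [alpha_small]
    bounds [n * alpha] and not just [alpha]. *)
Let eps_h : 16 * g%:R ^+ 2 * eps <= h.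
Proof.
have /andP[H1 _] := H2_bounds.
have -> : 16 * g%:R ^+ 2 * eps = (8 * g%:R * n%:R * alpha) ^+ 2 * (4^-1 * beta ^+ 2).
  by rewrite /eps /beta; field.
apply: (@le_trans _ _ (1 * (4^-1 * beta ^+ 2))).
  have b0 : 0 <= 4^-1 * beta ^+ 2 by apply: mulr_ge0; rewrite ?sqr_ge0 ?invr_ge0.
  have a0 := ltW alpha_gt0.
  by apply: ler_wpM2r b0 _ _ _; rewrite expr_le1 // !mulr_ge0.
by rewrite /h mul1r ler_wpM2r ?sqr_ge0 //; lra.
Qed.

Let h_small : h * g%:R < 1.
Proof.
(* The case [m = 1] of [om_le] bounds [h] itself. *)
have /andP[_] := om_le n_gt0; rewrite expr1n mulr1 => h4.
have : h * g%:R <= 4 * alpha ^+ 2 * g%:R by rewrite ler_wpM2r.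
have : alpha ^+ 2 * g%:R <= alpha ^+ 2 * g%:R ^+ 2.
  by rewrite ler_wpM2l ?sqr_ge0 // ler_eXnr // gk; move: k1; lra.
by move: ga2; lra.
Qed.

Let cross_ge (v w : V) : v.1 != w.1 -> 1 <= sqnorm (P v - P w).
Proof. by case/cross_dist/andP. Qed.

Let cross_le (v w : V) : v.1 != w.1 -> sqnorm (P v - P w) <= 1 + eps.
Proof. by case/cross_dist/andP. Qed.

(** Truncated subtraction covers both ranges: [(G, j)] is [(p + 1, 0)] for [p <= k] and
    [(k + 1, p - k)] for [p >= k]. *)
Definition radius (p : nat) : R := Num.sqrt (threshold h (minn p k).+1 (p - k)).

Lemma radius_ltS p : (p < 2 * k)%N -> radius p < radius p.+1.
Proof.
move=> p2k; rewrite ltr_sqrt; first exact: threshold_ltS.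
exact: threshold_gt0.
Qed.

(** Different arcs are at distance at least 1, and the lower bound in [om_lower] is positive for
    distinct indices on one arc. *)
Lemma arc_point_inj : injective P.
Proof.
have P0 v : sqnorm (P v - P v) = 0 by rewrite subrr; apply: big1 => i _; rewrite mxE expr0n.
have arc_lt l (i i' : 'I_n.+1) : (i < i')%N -> P (l, i) <> P (l, i').
  move=> ii E; have := arc_dist l (ltnW ii); rewrite -E P0 => /esym om0.
  have m_n : (i' - i <= n)%N by apply: leq_trans (leq_subr _ _) _; rewrite -ltnS.
  have := om_lower m_n; rewrite om0; apply/negP; rewrite -ltNge.
  have A : 0 < h * (i' - i)%:R ^+ 2 by rewrite mulr_gt0 // exprn_gt0 // ltr0n subn_gt0.
  apply: mulr_gt0 A _; rewrite subr_gt0 invf_lt1 ?mulr_gt0 ?ltr0n //.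
  by rewrite gk; move: k1; lra.
move=> [l i] [l' i'] E; have [ll|ll] := eqVneq l l'; last first.
  by have := @cross_ge (l, i) (l', i') ll; rewrite E P0 ler10.
subst l'; case: (ltngtP i i') => [ii|ii|/ord_inj -> //].
  by case: (arc_lt _ _ _ ii E).
by case: (arc_lt _ _ _ ii (esym E)).
Qed.

Local Notation A := (arc_points u n Delta).

Lemma arc_pointsP x : reflect (exists v, x = P v) (x \in A).
Proof.
apply: (iffP (imfset2P _ _ _ _ _)) => [[l _ [i _ ->]]|[[l i] ->]]; first by exists (l, i).
by exists l => //; exists i.
Qed.

Let coord (a : A) : V := odflt (ord0, ord0) [pick v | P v == val a].

Let coordK (a : A) : P (coord a) = val a.
Proof.
rewrite /coord; case: pickP => [v /eqP //|noP].
by have /arc_pointsP[v vE] := valP a; have := noP v; rewrite vE eqxx.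
Qed.

Let coord_bij : bijective coord.
Proof.
have PA v : P v \in A by apply/arc_pointsP; exists v.
exists (fun v => [` PA v]%fset) => [a|v]; first by apply: val_inj; rewrite /= coordK.
by apply: arc_point_inj; rewrite coordK.
Qed.

Lemma card_arc_points : #|` A| = (g * n.+1)%N.
Proof. by rewrite cardfE (bij_eq_card coord_bij) card_prod !card_ord. Qed.

Let cech_enclosed r (s : {set A}) : 0 <= r ->
  (s \in cech A r) <-> s != set0 /\ enclosed P (coord @: s) (r ^+ 2).
Proof.
move=> r0; rewrite inE; split=> [/andP[s0 /asboolP[x xs]]|[s0 [x xs]]].
  split=> //; exists x => _ /imsetP[a sa ->].
  by rewrite coordK -enorm_le //; apply: xs.
rewrite s0; apply/asboolP; exists x => a sa.
by rewrite /in_cball enorm_le // -coordK; apply/xs/imset_f.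
Qed.

(** The estimates above are the hypotheses of [enclosed_threshold], which identifies the Cech
    complex with the model. *)
Let cech_spread G j (s : {set A}) : (0 < G <= g)%N -> (j <= k)%N ->
  (s \in cech A (Num.sqrt (threshold h G j))) = (coord @: s \in spread_complex g n G j).
Proof.
move=> /andP[G0 Gg] jk; have t0 := ltW (threshold_gt0 h_gt0 j G0).
have E : s != set0 -> enclosed P (coord @: s) (threshold h G j) <->
    (#|groups (coord @: s)| < G)%N || (#|groups (coord @: s)| == G) && (cost (coord @: s) <= j)%N.
  move=> s0; apply: (@enclosed_threshold _ _ _ _ P om eps h) => //; last by rewrite G0.
  by rewrite card_gt0 !imset_eq0.
apply/idP/idP => [/(cech_enclosed _ (sqrtr_ge0 _))|].
  by rewrite sqr_sqrtr // => -[s0 /(E s0) H']; rewrite inE imset_eq0 s0.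
rewrite inE imset_eq0 => /andP[s0 /(E s0) H'].
by apply/(cech_enclosed _ (sqrtr_ge0 _)); rewrite sqr_sqrtr.
Qed.

Lemma cech_betti_low (F : fieldType) p : (p <= k)%N ->
  let b := reduced_betti F (cech A (radius p)) p in
  (b <= 'C(g, p.+1) * n.+1 ^ p.+1)%N /\ ('C(g, p.+1) * n.+1 ^ p.+1 <= b + 2 ^ k.+2)%N.
Proof.
move=> pk; apply: (betti_spread_low F coord_bij) => s.
rewrite /radius (minn_idPl pk) (_ : (p - k)%N = 0%N); last by apply/eqP; rewrite subn_eq0.
by rewrite cech_spread.
Qed.

Lemma cech_betti_high (F : fieldType) p : (k < p <= 2 * k)%N ->
  let b := reduced_betti F (cech A (radius p)) p in
  (b <= n ^ g * 'C(k, p - k) + (n.+1 ^ g - n ^ g) * 2 ^ g)%N /\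
  (n ^ g * 'C(k, p - k) <= b + 2 ^ k.+2)%N.
Proof.
move=> /andP[kp p2k]; have [j pE] : exists j, p = (k + j)%N by exists (p - k)%N; rewrite subnKC // ltnW.
subst p; rewrite addKn; apply: (betti_spread_high F coord_bij) => [|s].
  by rewrite -(ltn_add2l k) addn0.
rewrite /radius (minn_idPr (leq_addr _ _)) addKn cech_spread ?leqnn //.
by rewrite -(leq_add2l k) addnn -mul2n.
Qed.

End ArcPoints.

(** * Numerical estimates and conclusion *)

Lemma expn_succ_sub (n m : nat) : (n.+1 ^ m.+1 <= n ^ m.+1 + m.+1 * n.+1 ^ m)%N.
Proof.
elim: m => [|m IH]; first by rewrite !expn1 mul1n expn0 addn1.
rewrite expnS (leq_trans (leq_mul (leqnn n.+1) IH)) // mulnDr mulnCA -expnS.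
rewrite mulSn -expnS [(n ^ _ + _)%N]addnC -addnA leq_add2l mulSn leq_add2r.
by rewrite leq_exp2r.
Qed.

Lemma bin_le_exp (k j : nat) : ('C(k, j) <= 2 ^ k)%N.
Proof.
rewrite -{1 2}[k]card_ord -card_draws -cardsT -card_powerset.
by apply/subset_leq_card/subsetP => B _; rewrite inE subsetT.
Qed.

Lemma natr_dist_le (R : realType) (a b c : nat) : (a <= b + c)%N -> (b <= a + c)%N ->
  `| a%:R - b%:R | <= c%:R :> R.
Proof.
move=> ab ba; rewrite ler_distl lerBlDr -!natrD !ler_nat.
by rewrite ba ab.
Qed.

Section ThresholdAngle.
Variables (R : realType) (k n : nat).
Hypotheses (k_gt0 : (0 < k)%N) (n_gt0 : (0 < n)%N).

Lemma small_angle : exists2 Delta0 : R, 0 < Delta0 &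
  forall Delta, 0 < Delta -> Delta < Delta0 -> Delta < height R k ->
  0 < asin (Delta / height R k) /\
  8 * k.+1%:R * n%:R * asin (Delta / height R k) <= 1.
Proof.
have H0 : 0 < height R k by apply: height_gt0.
pose c : R := 8 * k.+1%:R * n%:R; pose a0 := c^-1.
have c8 : 8 <= c by rewrite /c -mulrA ler_peMr // -natrM ler1n muln_gt0.
have c0 : 0 < c by lra.
have a0_gt0 : 0 < a0 by rewrite invr_gt0.
have a0_lt : a0 <= pi / 2.
  apply: le_trans (pihalf_ge1 R); rewrite invf_le1 //; lra.
(* The witness is the value of [Delta] with arc angle [a0]; since [a0 <= pi / 2], monotonicity of
   [sin] puts the angle of any smaller [Delta] below [a0]. *)
have p0 := pi_gt0 R.
exists (height R k * sin a0).
  by rewrite mulr_gt0 // sin_gt0_pi // a0_gt0 /=; move: a0_lt; lra.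
move=> Delta D0 D1 D2; set x := Delta / _.
have x0 : 0 < x by rewrite divr_gt0.
have x1 : x < 1 by rewrite ltr_pdivrMr // mul1r.
have xs : x < sin a0 by rewrite ltr_pdivrMr // mulrC.
have xin : x \in `[(-1), 1] by rewrite in_itv /=; lra.
have xB : -1 <= x <= 1 by lra.
have ain : asin x \in `[(- (pi / 2)), pi / 2].
  by rewrite in_itv /= asin_geNpi2 // asin_lepi2.
have sK : sin (asin x) = x by apply: asinK.
split.
  by rewrite -(ltr_sin _ ain) ?sin0 ?sK // in_itv /=; lra.
have : asin x < a0 by rewrite -(ltr_sin ain) ?sK // in_itv /=; move: a0_gt0; lra.
by rewrite /a0 -[c^-1]mul1r ltr_pdivlMr // mulrC => /ltW.
Qed.

End ThresholdAngle.

(** Passing from [n ^ k.+1] to [n.+1 ^ k.+1] costs [D <= k.+1 * n.+1 ^ k], at most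
    [k.+1 * 2 ^ k * n ^ k] since [n.+1 <= 2 * n]. *)
Lemma betti_high_arith (k n j b : nat) : (0 < n)%N ->
  (b <= n ^ k.+1 * 'C(k, j) + (n.+1 ^ k.+1 - n ^ k.+1) * 2 ^ k.+1)%N ->
  (n ^ k.+1 * 'C(k, j) <= b + 2 ^ k.+2)%N ->
  let c := ((2 ^ k.+1 * (k.+1 * 2 ^ k) + 2 ^ k.+2) * n ^ k)%N in
  (b <= 'C(k, j) * n.+1 ^ k.+1 + c)%N /\ ('C(k, j) * n.+1 ^ k.+1 <= b + c)%N.
Proof.
move=> n0 ub lb c; set D := (n.+1 ^ k.+1 - n ^ k.+1)%N in ub *.
have nk : (n ^ k.+1 <= n.+1 ^ k.+1)%N by rewrite leq_exp2r.
have E : (n.+1 ^ k.+1 = n ^ k.+1 + D)%N by rewrite subnKC.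
have D_le : (D <= k.+1 * 2 ^ k * n ^ k)%N.
  rewrite leq_subLR; apply: leq_trans (expn_succ_sub n k) _.
  rewrite leq_add2l -mulnA leq_mul2l /= -expnMn; case: (k) => // k'.
  by rewrite leq_exp2r // mul2n -addnn -addn1 leq_add2l.
have D2 : (D * 2 ^ k.+1 <= 2 ^ k.+1 * (k.+1 * 2 ^ k) * n ^ k)%N.
  by rewrite mulnC -mulnA leq_mul2l D_le orbT.
have D3 : ('C(k, j) * D <= D * 2 ^ k.+1)%N.
  by rewrite mulnC leq_mul2l (leq_trans (bin_le_exp k j)) ?orbT // leq_exp2l.
have nk1 : (2 ^ k.+2 <= 2 ^ k.+2 * n ^ k)%N by rewrite leq_pmulr // expn_gt0 n0.
rewrite E mulnDr /c mulnDl [('C(k, j) * n ^ _)%N]mulnC; lia.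
Qed.

Local Open Scope fset_scope.

Theorem mainTheorem4 (R : realType) (k : nat) (hk : (1 <= k)%N) :
  exists C : R, forall n : nat, (2 <= n)%N ->
  exists2 Delta0 : R, 0 < Delta0 &
  forall Delta : R, 0 < Delta -> Delta < Delta0 -> Delta < height R k ->
  forall u : 'I_k.+1 -> 'rV[R]_(k + k.+1), unit_regular_simplex u ->
  let A := arc_points u n Delta in
  #|` A| = (k.+1 * n.+1)%N /\
  exists rho : nat -> R,
    [/\ 0 <= rho 0%N,
        forall p : nat, (p < 2 * k)%N -> rho p < rho p.+1
      & forall F : fieldType,
        (forall p : nat, (p <= k)%N ->
           `| (reduced_betti F (cech A (rho p)) p)%:R
              - ('C(k.+1, p.+1) * n.+1 ^ p.+1)%:R | <= C) /\
        (forall p : nat, (k.+1 <= p <= 2 * k)%N ->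
           `| (reduced_betti F (cech A (rho p)) p)%:R
              - ('C(k, p - k) * n.+1 ^ k.+1)%:R | <= C * n%:R ^+ k)].
Proof.
(* The first summand covers the boundary staircases and the change from [n] to [n.+1]; the second
   covers the sets of top points that are critical in the two adjacent dimensions. *)
exists (2 ^ k.+1 * (k.+1 * 2 ^ k) + 2 ^ k.+2)%:R => n n2.
have n0 : (0 < n)%N by apply: leq_trans n2.
have [Delta0 D0 small] := @small_angle R k n hk n0.
exists Delta0 => // Delta Dpos DD DH u hu A.
have [a_gt0 a_small] := small Delta Dpos DD DH.
split; first exact: card_arc_points.
exists (@radius R k n Delta); split=> [|p p2k|F]; first exact: sqrtr_ge0.
  exact: radius_ltS.
split=> p hp.
  have [ub lb] := cech_betti_low hk n0 hu a_gt0 a_small F hp.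
  apply: le_trans (_ : (2 ^ k.+2)%:R <= _); last by rewrite ler_nat leq_addl.
  by apply: natr_dist_le => //; apply: leq_trans ub _; apply: leq_addr.
have [ub lb] := cech_betti_high hk n0 hu a_gt0 a_small F hp.
by rewrite -natrX -natrM; have [? ?] := betti_high_arith n0 ub lb; apply: natr_dist_le.
Qed.
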